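(* Let $f:\mathbb{C}\to\mathbb{C}$ be a polynomial of degree $d\ge3$ such that exactly one of its $d-1$ critical points (counted with multiplicity) has bounded orbit; denote this critical point by $c_0$ and its orbit by $c_0\mapsto c_1\mapsto c_2\mapsto\cdots$. Suppose that the critical tableau is periodic of period $p\ge1$, so that $P_k(c_0)=P_k(c_p)$ for all depths $k$. Then the connected component of the filled Julia set $K=K(f)$ which contains $c_0$ is non-trivial, that is, consists of more than one point. In fact, a connected component of $K$ is non-trivial if and only if it contains some iterated pre-image of $c_0$ (that is, a point $z$ with $f^{\circ n}(z)=c_0$ for some $n\ge0$).
   Context: $K$ is the filled Julia set of $f$, and $G:\mathbb{C}\to[0,\infty)$ is the canonical potential (Green's) function of $f$, which satisfies $G(f(z))=d\,G(z)$ and vanishes precisely on $K$. The critical point $c_0$ is simple; the other $d-2$ critical points (with multiplicity) have orbits escaping to infinity. Branner–Hubbard puzzle: fix a number $G_0>0$ which is not a critical value of $G$ and such that the region $G^{-1}(0,G_0]$ contains no critical value of $f$. The puzzle pieces of depth $k\ge0$ are the connected components of $\{z: G(z)\le G_0/d^k\}$; they are closed topological disks. For $z\in K$, $P_k(z)$ is the puzzle piece of depth $k$ containing $z$. The critical tableau is periodic if there is some $p\ge1$ with $P_k(c_p)=P_k(c_0)$ for all depths $k$. *)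

(* Defs.v *)
From HB Require Import structures.
From mathcomp Require Import all_boot all_order all_algebra.
From mathcomp Require Import all_classical all_reals all_analysis.
From mathcomp Require Import complex.

Set Implicit Arguments.
Unset Strict Implicit.
Unset Printing Implicit Defensive.

Import Order.TTheory GRing.Theory Num.Theory.
Import numFieldNormedType.Exports.

Local Open Scope classical_set_scope.
Local Open Scope ring_scope.
Local Open Scope complex_scope.

(* MathComp-Analysis attaches the norm topology to an abstract
   numClosedFieldType, but does not find it on the concrete carrier R[i]. *)
HB.instance Definition _ (R : rcfType) :=
  Uniform.copy R[i] (R[i] : numClosedFieldType).
HB.instance Definition _ (R : rcfType) :=
  NormedModule.copy R[i] (R[i] : numClosedFieldType)^o.

Section PolynomialDynamics.
Variable R : realType.
Implicit Types (f : {poly R[i]}) (z c : R[i]).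

Definition iterate f (n : nat) z : R[i] := iter n (fun w => f.[w]) z.

Definition filled_julia f : set R[i] :=
  [set z | bounded_fun (fun n : nat => iterate f n z)].

Definition critical_point f c : Prop := root f^`() c.

(* The critical points of f, counted with multiplicity, are the roots of f'. *)
Definition sole_bounded_critical_point f c0 : Prop :=
  [/\ filled_julia f c0,
      mup c0 f^`() = 1%N &
      forall c, critical_point f c -> filled_julia f c -> c = c0].

(* G(z) = lim_n log^+ |f^n(z)| / d^n, where d = deg f, log^+ t = log (max 1 t),
   and normc is the R-valued modulus. *)
Definition green f z : R :=
  limn (fun n : nat =>
    ln (Num.max 1 (ComplexField.Normc.normc (iterate f n z)))
      / ((size f).-1%:R ^+ n)).

(* G is only real-differentiable, so its differential is taken on R * R;
   being critical means that G is differentiable at z with differential 0. *)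
Definition green_critical_point f z : Prop :=
  is_diff ((complex.Re z, complex.Im z) : R * R)
    (fun p : R * R => green f (p.1 +i* p.2)) (fun=> 0 : R).

Definition green_critical_value f (t : R) : Prop :=
  exists2 z, green_critical_point f z & green f z = t.

Definition puzzle_level f (G0 : R) : Prop :=
  [/\ 0 < G0,
      ~ green_critical_value f G0 &
      forall c, critical_point f c -> ~ (0 < green f f.[c] <= G0)].

Definition puzzle_piece f (G0 : R) (k : nat) z : set R[i] :=
  connected_component
    [set w | green f w <= G0 / ((size f).-1%:R ^+ k)] z.

Definition critical_tableau_periodic f (G0 : R) c0 (p : nat) : Prop :=
  (0 < p)%N /\
  forall k : nat, puzzle_piece f G0 k (iterate f p c0) = puzzle_piece f G0 k c0.

Definition nontrivial (A : set R[i]) : Prop :=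
  exists x y : R[i], [/\ A x, A y & x <> y].

End PolynomialDynamics.

(* Main.v *)
Require Import Defs.
From mathcomp Require Import all_boot all_order all_algebra.
From mathcomp Require Import all_classical all_reals all_analysis.
From mathcomp Require Import complex.
From mathcomp Require Import ring lra.
Import Order.TTheory GRing.Theory Num.Theory.
Import numFieldNormedType.Exports.
Local Open Scope classical_set_scope.
Local Open Scope ring_scope.
Local Open Scope complex_scope.

(* Write U_k for the set where |f^k| is below an escape radius and P_k(z) for the
   component of U_k at z (these replace the puzzle pieces cut out by G); the component of z in K is the intersection of the
   P_k(z).  The lower bound on Green's function far from K turns the tableau
   hypothesis into: the component K_0 of c_0 in K contains c_p.

   K_0 is non-trivial: if c_p = c_0, then c_0 is a superattracting periodic point
   and a disc around it lies in K.  Since f^n maps components of K onto components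
   of K, every component containing a preimage of c_0 is non-trivial.

   Conversely, let z_0 lie in a component no iterate of which is K_0.  The orbit of
   K_0 is isolated among the components of its preimage under f, so the orbit of z_0
   is not trapped near it: for a fixed depth M, infinitely many of the pieces
   P_M(f^n(z_0)) contain no point of the orbit of c_0.  For these n, f^n has no
   critical point in P_{M+n}(z_0), so it maps this piece bijectively onto one of
   finitely many pieces Q.  Pick e in Q outside K.  The preimages e_n of e in
   P_{M+n}(z_0) come arbitrarily close to points b_n outside P_{M+n}(z_0); a Harnack
   inequality for -log |z - b_n|, propagated along Q, shows that the preimages of a
   compact part of Q shrink to a point, and they contain the component of z_0.

   Bijectivity replaces simple connectedness: for a polynomial F, every component
   of {|F| < r} has exactly one critical point fewer than zeros, with multiplicity.  Indeed,
   as r grows components merge only through critical points of F, a critical point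
   of multiplicity m merges at most m + 1 of them, and the total number deg F - 1 of
   critical points leaves no room for a strict inequality. *)

Set Implicit Arguments.
Unset Strict Implicit.
Unset Printing Implicit Defensive.

(** * Topology of the plane *)

Section PlaneTopology.
Variable R : realType.
Local Notation C := R[i].
Local Notation N := (@ComplexField.Normc.normc R).
Implicit Types (x y z w : C) (A B U V Y : set C) (e r : R).

Lemma norm_normc z : `|z| = (N z)%:C.
Proof. by rewrite normc_def; case: z. Qed.

Lemma normc_ge0 z : 0 <= N z.
Proof. by rewrite -lecR -norm_normc normr_ge0. Qed.

Lemma normc_eq0 z : (N z == 0) = (z == 0).
Proof.
apply/eqP/eqP => [|->]; first exact: ComplexField.Normc.eq0_normc.
exact: ComplexField.Normc.normc0.
Qed.

Lemma normc_gt0 z : (0 < N z) = (z != 0).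
Proof. by rewrite lt_neqAle normc_ge0 andbT eq_sym normc_eq0. Qed.

Lemma normcM z w : N (z * w) = N z * N w.
Proof. exact: ComplexField.Normc.normcM. Qed.

Lemma normc1 : N 1 = 1.
Proof. exact: ComplexField.Normc.normc1. Qed.

Lemma normc0 : N 0 = 0.
Proof. exact: ComplexField.Normc.normc0. Qed.

Lemma normcX z n : N (z ^+ n) = N z ^+ n.
Proof.
by elim: n => [|n IH]; rewrite ?expr0 ?normc1// !exprS normcM IH.
Qed.

Lemma normcN z : N (- z) = N z.
Proof. by apply: complexI; rewrite -!norm_normc normrN. Qed.

Lemma normcB z w : N (z - w) = N (w - z).
Proof. by rewrite -normcN opprB. Qed.

Lemma normcD z w : N (z + w) <= N z + N w.
Proof. by rewrite -lecR rmorphD/= -!norm_normc ler_normD. Qed.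

Lemma normc_triangle y x z : N (x - z) <= N (x - y) + N (y - z).
Proof. by rewrite -(subrKA y) normcD. Qed.

Lemma normc_real r : N r%:C = `|r|.
Proof. by rewrite /= expr0n/= addr0 sqrtr_sqr. Qed.

Lemma normc_prod (I : Type) (s : seq I) (F : I -> C) :
  N (\prod_(i <- s) F i) = \prod_(i <- s) N (F i).
Proof. exact: (big_morph N normcM normc1). Qed.

Definition disc x r : set C := [set z | N (z - x) < r].

Lemma disc_center x r : 0 < r -> disc x r x.
Proof. by rewrite /disc/= subrr normc0. Qed.

Lemma nbhs_normcP z A : nbhs z A <-> exists2 e, 0 < e & disc z e `<=` A.
Proof.
rewrite nbhs_ballP; split=> [[e e0 eA]|[e e0 eA]].
  have eE : e = (complex.Re e)%:C.
    by rewrite RRe_real// ger0_real// ltW.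
  exists (complex.Re e); first by rewrite -(@ltcR R) -eE.
  move=> w zw; apply: eA; rewrite -ball_normE /ball_/=.
  by rewrite eE norm_normc ltcR normcB.
exists e%:C => [/=|w]; first by rewrite ltcR.
rewrite -ball_normE /ball_/= norm_normc ltcR normcB => zw.
exact: eA.
Qed.

Lemma open_normcP A :
  open A <-> forall z, A z -> exists2 e, 0 < e & disc z e `<=` A.
Proof.
by rewrite openE; split=> oA z Az; move/nbhs_normcP: (oA z Az).
Qed.

Lemma open_disc x r : open (disc x r).
Proof.
apply/open_normcP => z xz; exists (r - N (z - x)); first by rewrite subr_gt0.
move=> w zw; apply: (le_lt_trans (normc_triangle z _ _)).
by rewrite -ltrBrDr.
Qed.

Lemma closure_normcP A z :
  closure A z <-> forall e, 0 < e -> exists2 w, A w & N (w - z) < e.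
Proof.
split=> [cA e e0|cA B /nbhs_normcP[e e0 eB]].
  have /cA[w [Aw zw]] : nbhs z (disc z e) by apply/nbhs_normcP; exists e.
  by exists w.
by have [w Aw zw] := cA e e0; exists w; split=> //; apply: eB.
Qed.

Lemma closed_normcP A :
  closed A <-> forall z, (forall e, 0 < e -> exists2 w, A w & N (w - z) < e) -> A z.
Proof. by split=> cA z zA; apply: cA; apply/closure_normcP. Qed.

(** Clopen argument in which [U] and [V] are disjoint only on [Y]. *)
Lemma connected_open_split Y U V x : connected Y -> open U -> open V ->
  Y `<=` U `|` V -> Y `&` U `&` V = set0 -> Y x -> U x -> Y `<=` U.
Proof.
move=> cY oU oV YUV YUV0 Yx Ux.
have <- : Y `&` U = Y; last by move=> ? [].
apply: cY; first by exists x.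
  by exists U.
exists (~` V); first exact: open_closedC.
apply/seteqP; split=> y [Yy].
  move=> Uy; split=> // Vy.
  by have : (Y `&` U `&` V) y by []; rewrite YUV0.
by move=> Vy; split=> //; case: (YUV y Yy).
Qed.

Lemma connected_convex A :
  (forall x y t, A x -> A y -> 0 <= t <= 1 -> A (x + t%:C * (y - x))) ->
  connected A.
Proof.
move=> cA; have [->|/set0P[x Ax]] := eqVneq A set0; first exact: connected0.
pose S y := [set x + t%:C * (y - x) | t in `[0, 1]%classic].
have -> : A = \bigcup_(y in A) S y.
  apply/seteqP; split=> [y Ay|z [y Ay [t /=]]].
    exists y => //; exists 1; first by rewrite /= in_itv/= ler01 lexx.
    by rewrite mul1r addrC subrK.
  by rewrite in_itv/= => t01 <-; apply: cA.
apply: bigcup_connected => [|y Ay].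
  exists x => y Ay; exists 0; first by rewrite /= in_itv/= lexx ler01.
  by rewrite mul0r addr0.
apply: connected_continuous_connected; first exact: segment_connected.
apply: continuous_subspaceT => t; apply/cvgrPdist_lt => e e0.
have eE : e = (complex.Re e)%:C by rewrite RRe_real// ger0_real// ltW.
have e'0 : 0 < complex.Re e by rewrite -(@ltcR R) -eE.
near=> s.
rewrite opprD addrACA subrr add0r -mulrBl -rmorphB/=.
rewrite eE norm_normc ltcR normcM normc_real.
apply: (@le_lt_trans _ _ (`|t - s| * (N (y - x) + 1))).
  by rewrite ler_wpM2l// lerDl.
rewrite -ltr_pdivlMr ?ltr_wpDl ?normc_ge0//.
near: s; exists (complex.Re e / (N (y - x) + 1)); last by [].
by apply: divr_gt0 => //; rewrite ltr_wpDl ?normc_ge0.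
Unshelve. all: by end_near. Qed.

Lemma disc_convex x r y z t : disc x r y -> disc x r z -> 0 <= t <= 1 ->
  disc x r (y + t%:C * (z - y)).
Proof.
rewrite /disc/= => xy xz /andP[t0 t1].
have -> : y + t%:C * (z - y) - x = (1 - t)%:C * (y - x) + t%:C * (z - x).
  by rewrite rmorphB/= rmorph1; ring.
apply: (le_lt_trans (normcD _ _)); rewrite !normcM !normc_real.
rewrite !ger0_norm ?subr_ge0//.
have [->|t0'] := eqVneq t 0; first by rewrite subr0 mul1r mul0r addr0.
have : t * N (z - x) < t * r by rewrite ltr_pM2l// lt_neqAle eq_sym t0'.
have : (1 - t) * N (y - x) <= (1 - t) * r by rewrite ler_wpM2l ?subr_ge0// ltW.
lra.
Qed.

Lemma connected_disc x r : connected (disc x r).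
Proof. by apply: connected_convex => *; apply: disc_convex. Qed.

Lemma open_component A x : open A -> open (connected_component A x).
Proof.
move=> /open_normcP oA; apply/open_normcP => y Axy.
have [e e0 eA] := oA _ (connected_component_sub Axy).
exists e => //; rewrite (same_connected_component Axy).
by apply: connected_component_max => //; [exact: disc_center|exact: connected_disc].
Qed.

Lemma component_absorb A x Y y : connected Y -> Y `<=` A -> Y y ->
  connected_component A x y -> Y `<=` connected_component A x.
Proof.
move=> cY YA Yy Axy; rewrite (same_connected_component Axy).
exact: connected_component_max.
Qed.

(** * Compactness and nested intersections *)

Lemma compact_cdisc r : compact [set z | N z <= r].
Proof.
pose Q := [set z.1 +i* z.2 | z in `[- r, r]%classic `*` `[- r, r]%classic] : set C.
have na (c : R) d : 0 < d -> nbhs c [set t | `|c - t| < d] by exists d.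
have cQ : compact Q.
  apply: continuous_compact.
    apply: continuous_subspaceT => -[a b]; apply/cvgrPdist_lt => e e0.
    have eE : e = (complex.Re e)%:C by rewrite RRe_real// ger0_real// ltW.
    have e'0 : 0 < complex.Re e by rewrite -(@ltcR R) -eE.
    near=> s.
    have -> : (a, b).1 +i* (a, b).2 - (s.1 +i* s.2) =
              (a - s.1)%:C + (b - s.2)%:C * 'i.
      by apply/eqP; rewrite eq_complex; simpc.
    rewrite eE norm_normc ltcR; apply: (le_lt_trans (normcD _ _)).
    rewrite normcM !normc_real.
    have -> : N 'i = 1 by rewrite /= expr0n/= add0r expr1n sqrtr1.
    rewrite mulr1 (splitr (complex.Re e)) ltrD//; near: s.
      exists ([set t | `|a - t| < complex.Re e / 2], setT); last by move=> ? [].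
      by split; [apply: na; rewrite divr_gt0|exact: filterT].
    exists (setT, [set t | `|b - t| < complex.Re e / 2]); last by move=> ? [].
    by split; [exact: filterT|apply: na; rewrite divr_gt0].
  by apply: compact_setX; exact: segment_compact.
apply: (subclosed_compact _ cQ).
  apply/closed_normcP => z zA /=; rewrite leNgt; apply/negP => rz.
  have zr : 0 < N z - r by rewrite subr_gt0.
  have [w /= wr] := zA _ zr.
  have := normc_triangle w z 0; rewrite !subr0 (normcB z w).
  lra.
move=> [a b] /= ab; exists (a, b) => //; rewrite /= !in_itv/= -!ler_norml.
split; apply: le_trans ab; rewrite -sqrtr_sqr ler_wsqrtr//.
  by rewrite lerDl sqr_ge0.
by rewrite lerDr sqr_ge0.
Unshelve. all: by end_near. Qed.

(** Bolzano-Weierstrass along the indices satisfying [P]; applying it again to a refined [P]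
    replaces passing to subsequences. *)
Lemma bounded_cluster (P : nat -> Prop) (u : nat -> C) r :
  (forall m, exists2 n, (m <= n)%N & P n) -> (forall n, P n -> N (u n) <= r) ->
  exists q, forall e, 0 < e -> forall m, exists n, [/\ (m <= n)%N, P n & N (u n - q) < e].
Proof.
move=> infP ur.
have /choice[phi phiP] : forall m, exists n, (m <= n)%N /\ P n.
  by move=> m; have [n mn Pn] := infP m; exists n.
have [] := @compact_cdisc r ((u \o phi) @ \oo).
  by exists 0%N => // n _ /=; apply: ur; case: (phiP n).
move=> q [_ qc]; exists q => e e0 m.
have [] := qc [set u n | n in [set n | (m <= n)%N /\ P n]] (disc q e).
  exists m => // n /= mn; exists (phi n) => //; have [nphi Pphi] := phiP n.
  by split=> //; exact: leq_trans nphi.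
  by apply/nbhs_normcP; exists e.
by move=> _ [[n [mn Pn] <-] qe]; exists n.
Qed.

(** The two parts of a separation of the intersection have disjoint open neighbourhoods. Each
    connected [X n] meets both, hence has a point outside them, and a cluster point of these points
    lies in the intersection, a contradiction. *)
Lemma connected_bigcap_nested (X : nat -> set C) r :
  (forall n, closed (X n)) -> (forall n, connected (X n)) ->
  (forall n, X n.+1 `<=` X n) -> (forall z, X 0%N z -> N z <= r) ->
  connected (\bigcap_n X n).
Proof.
move=> clX cX XS Xr; apply/connectedP => E [E0 EI [sep1 sep2]].
have Xle m n : (m <= n)%N -> X n `<=` X m.
  move=> /subnK <-; elim: (n - m)%N => [//|k IH] z; rewrite addSn => /XS.
  exact: IH.
have sepE b z : E b z -> exists2 e, 0 < e & disc z e `&` E (~~ b) = set0.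
  move=> Ebz; apply: contrapT => h.
  have : closure (E (~~ b)) z.
    apply/closure_normcP => e e0; apply: contrapT => h'; apply: h.
    exists e => //; rewrite -subset0 => w [zw Ew]; apply: h'.
    by exists w.
  case: b Ebz h => /= Ebz _ h.
    by have : (closure (E false) `&` E true) z by []; rewrite sep1.
  by have : (E false `&` closure (E true)) z by []; rewrite sep2.
have /choice[rho rhoP] : forall bz : bool * C, exists e, E bz.1 bz.2 ->
    0 < e /\ disc bz.2 e `&` E (~~ bz.1) = set0.
  move=> [b z]; have [/sepE[e]|nE] := pselect (E b z); last by exists 0.
  by exists e.
(* Halving the radii makes the two unions of discs disjoint. *)
pose U b := \bigcup_(z in E b) disc z (rho (b, z) / 2).
have oU b : open (U b) by apply: bigcup_open => z _; exact: open_disc.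
have EU b z : E b z -> U b z.
  move=> Ez; exists z => //; apply: disc_center; apply: divr_gt0 => //.
  by case: (rhoP (b, z) Ez).
have U0 : U false `&` U true = set0.
  rewrite -subset0 => w [[x Ex xw] [y Ey yw]].
  have [x0 xE] := rhoP (false, x) Ex; have [y0 yE] := rhoP (true, y) Ey.
  have xy : N (x - y) < rho (false, x) / 2 + rho (true, y) / 2.
    by apply: (le_lt_trans (normc_triangle w _ _)); rewrite ltrD// normcB.
  have [le|lt] := leP (rho (false, x)) (rho (true, y)).
    have : (disc y (rho (true, y)) `&` E false) x.
      by split=> //; apply: (lt_le_trans xy); lra.
    by rewrite yE.
  have : (disc x (rho (false, x)) `&` E true) y.
    by split=> //; rewrite /disc/= normcB; apply: (lt_le_trans xy); lra.
  by rewrite xE.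
have [a Ea] := E0 false; have [b Eb] := E0 true.
have EX c z n : E c z -> X n z.
  move=> Ez; have : (\bigcap_n X n) z by rewrite EI; case: c Ez => Ez; [right|left].
  exact.
have /choice[w wP] : forall n, exists w, X n w /\ ~ U false w /\ ~ U true w.
  move=> n; apply: contrapT => h.
  have XU : X n `<=` U false.
    apply: (@connected_open_split _ _ (U true) a) => //.
    - move=> w Xw; apply: contrapT => /not_orP[h1 h2]; apply: h.
      by exists w.
    - by rewrite -setIA U0 setI0.
    - exact: EX Ea.
    - exact: EU.
  have : (U false `&` U true) b by split; [apply: XU; exact: EX Eb|exact: EU].
  by rewrite U0.
have [] := @bounded_cluster (fun=> True) w r.
- by move=> m; exists m.
- by move=> n _; apply: Xr; apply: (Xle 0%N n) => //; case: (wP n).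
move=> q qP.
have : (\bigcap_n X n) q.
  move=> m _; move/closed_normcP: (clX m); apply=> e e0.
  have [n [mn _ wq]] := qP e e0 m.
  by exists (w n) => //; apply: Xle mn _ _; case: (wP n).
have nU c : ~ U c q.
  move=> Uq; have /open_normcP/(_ _ Uq)[e e0 eU] := oU c.
  have [n [_ _ wq]] := qP e e0 0%N.
  by have [_ [h1 h2]] := wP n; case: c eU {Uq} => /(_ _ wq).
by rewrite EI => -[] /EU/nU.
Qed.

End PlaneTopology.

(** * Polynomial maps *)

Section PolynomialMaps.
Variable R : realType.
Local Notation C := R[i].
Local Notation N := (@ComplexField.Normc.normc R).
Implicit Types (p q : {poly C}) (x y z w : C) (A B U V Y : set C) (e r : R).

(** For nonzero [p] the roots are repeated according to multiplicity, so counting in this list is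
    counting with multiplicity. *)
Definition rootseq p : seq C := sval (closed_field_poly_normal p).

Lemma poly_rootseq p : p = lead_coef p *: \prod_(z <- rootseq p) ('X - z%:P).
Proof. by rewrite /rootseq; case: (closed_field_poly_normal p). Qed.

Lemma mem_rootseq p z : p != 0 -> (z \in rootseq p) = root p z.
Proof.
move=> p0; rewrite {2}(poly_rootseq p) rootZ ?lead_coef_eq0//.
by rewrite root_prod_XsubC.
Qed.

Lemma size_rootseq p : p != 0 -> size (rootseq p) = (size p).-1.
Proof.
move=> p0; rewrite {2}(poly_rootseq p) size_scale ?lead_coef_eq0//.
by rewrite size_prod_XsubC.
Qed.

Lemma normc_horner p z :
  N p.[z] = N (lead_coef p) * \prod_(x <- rootseq p) N (z - x).
Proof.
rewrite {1}(poly_rootseq p) hornerZ normcM horner_prod normc_prod.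
by congr (_ * _); apply: eq_bigr => x _; rewrite hornerXsubC.
Qed.

Lemma normc_lead_gt0 p : p != 0 -> 0 < N (lead_coef p).
Proof. by move=> p0; rewrite normc_gt0 lead_coef_eq0. Qed.

(* If all roots are at distance at least [e] from [z], then |p(z)| is at least |lead p| e^deg.
   Both the openness and the properness of polynomial maps are read off from this. *)
Lemma near_root p z e : p != 0 -> 0 < e ->
  N p.[z] < N (lead_coef p) * e ^+ (size p).-1 ->
  exists2 x, root p x & N (z - x) < e.
Proof.
move=> p0 e0; rewrite normc_horner ltr_pM2l ?normc_lead_gt0// -size_rootseq//.
move=> h; apply: contrapT => hn.
have {}hn x : x \in rootseq p -> e <= N (z - x).
  rewrite mem_rootseq// leNgt => px; apply/negP => zx; apply: hn.
  by exists x.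
elim: (rootseq p) h hn => [|x s IH].
  by rewrite big_nil expr0 ltxx.
rewrite big_cons /= exprS => h hn; apply: IH.
  have ex : e <= N (z - x) by apply: hn; rewrite mem_head.
  rewrite -(ltr_pM2l e0); apply: le_lt_trans h.
  by rewrite ler_wpM2r// prodr_ge0// => i _; exact: normc_ge0.
by move=> y ys; apply: hn; rewrite in_cons ys orbT.
Qed.

Lemma horner_cont p z e : 0 < e ->
  exists2 d, 0 < d & forall w, N (w - z) < d -> N (p.[w] - p.[z]) < e.
Proof.
elim/poly_ind: p e => [|p c IH] e e0.
  by exists 1 => // w _; rewrite !horner0 subrr normc0.
pose M := N z + 1 + N p.[z] + 1.
have M0 : 0 < M.
  have := normc_ge0 z; have := normc_ge0 p.[z]; rewrite /M; lra.
have [|d d0 dP] := IH (e / 2 / M); first by rewrite !divr_gt0.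
exists (Num.min 1 (Num.min d (e / 2 / M))).
  by rewrite !lt_min ltr01 d0 !divr_gt0.
move=> w; rewrite !lt_min => /and3P[w1 wd we].
rewrite !hornerMXaddC.
have -> : p.[w] * w + c - (p.[z] * z + c) =
          (p.[w] - p.[z]) * w + p.[z] * (w - z) by ring.
apply: (le_lt_trans (normcD _ _)); rewrite !normcM.
have wM : N w <= M.
  have := normcD (w - z) z; rewrite subrK; have := normc_ge0 p.[z].
  rewrite /M; lra.
have pM : N p.[z] <= M by have := normc_ge0 z; rewrite /M; lra.
rewrite [e]splitr; apply: ltr_leD.
  apply: (@le_lt_trans _ _ (N (p.[w] - p.[z]) * M)).
    by rewrite ler_wpM2l// normc_ge0.
  by rewrite -ltr_pdivlMr//; apply: dP.
apply: (@le_trans _ _ (M * N (w - z))).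
  by rewrite ler_wpM2r// normc_ge0.
by rewrite mulrC -ler_pdivlMr// ltW.
Qed.

Lemma horner_continuous p : continuous (fun z => p.[z]).
Proof.
move=> z A /nbhs_normcP[e e0 eA].
have [d d0 dP] := horner_cont p z e0.
by apply/nbhs_normcP; exists d => // w zw; apply: eA; apply: dP.
Qed.

Lemma open_preimage p U : open U -> open [set z | U p.[z]].
Proof.
by move=> oU; apply: open_comp => // z _; exact: horner_continuous.
Qed.

Lemma connected_image p A : connected A -> connected [set p.[z] | z in A].
Proof.
move=> cA; apply: connected_continuous_connected => //.
by apply: continuous_subspaceT; exact: horner_continuous.
Qed.

Lemma nonconst_neq0 p : (1 < size p)%N -> p != 0.
Proof. by move=> p1; rewrite -size_poly_gt0 ltnW. Qed.

Lemma size_subC p y : (1 < size p)%N -> size (p - y%:P) = size p.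
Proof.
move=> p1; rewrite size_polyDl// size_polyN size_polyC.
by apply: leq_ltn_trans p1; case: (y != 0).
Qed.

Lemma lead_coef_subC p y : (1 < size p)%N -> lead_coef (p - y%:P) = lead_coef p.
Proof.
move=> p1; rewrite lead_coefDl// size_polyN size_polyC.
by apply: leq_ltn_trans p1; case: (y != 0).
Qed.

Lemma root_subC p y z : root (p - y%:P) z = (p.[z] == y).
Proof. by rewrite /root !hornerE subr_eq0. Qed.

(** Quantitative openness: the radius about [p.[z]] covered by the image of the disc of radius [e]
    depends on [p] and [e] alone, because [p - y] has the degree and leading coefficient of [p]. *)
Lemma near_preimage p y z e : (1 < size p)%N -> 0 < e ->
  N (p.[z] - y) < N (lead_coef p) * e ^+ (size p).-1 ->
  exists2 x, p.[x] = y & N (z - x) < e.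
Proof.
move=> p1 e0 h; have [|||x] := @near_root (p - y%:P) z e => //.
- by apply: nonconst_neq0; rewrite size_subC.
- by rewrite lead_coef_subC// size_subC// !hornerE.
- by rewrite root_subC => /eqP <- zx; exists x.
Qed.

Lemma lead_pow_gt0 p e : (1 < size p)%N -> 0 < e ->
  0 < N (lead_coef p) * e ^+ (size p).-1.
Proof.
by move=> p1 e0; rewrite mulr_gt0 ?exprn_gt0// normc_lead_gt0// nonconst_neq0.
Qed.

Lemma surj_poly p y : (1 < size p)%N -> exists x, p.[x] = y.
Proof.
move=> p1; have /closed_rootP[x] : size (p - y%:P) != 1%N.
  by rewrite size_subC// neq_ltn p1 orbT.
by rewrite root_subC => /eqP px; exists x.
Qed.

Lemma bounded_preimage p r : (1 < size p)%N ->
  exists rho, forall z, N p.[z] <= r -> N z <= rho.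
Proof.
move=> p1; have p0 := nonconst_neq0 p1.
have l0 := normc_lead_gt0 p0.
pose e := 1 + `|r| / N (lead_coef p).
have e1 : 1 <= e by rewrite lerDl divr_ge0// ltW.
exists (e + \sum_(x <- rootseq p) N x) => z zr.
have [|||x px zx] := @near_root p z e => //; first exact: lt_le_trans e1.
  apply: (@lt_le_trans _ _ (N (lead_coef p) * e)).
    rewrite /e mulrDr mulr1 mulrCA divff ?gt_eqF// mulr1.
    by apply: (le_lt_trans zr); have := ler_norm r; lra.
  rewrite ler_pM2l// -[X in X <= _]expr1 ler_weXn2l//.
  by move: p1; case: (size p) => [|[]].
have := normc_triangle x z 0; rewrite !subr0.
suff : N x <= \sum_(y <- rootseq p) N y by lra.
rewrite -mem_rootseq// in px.
rewrite (big_rem x)//= lerDl sumr_ge0// => y _; exact: normc_ge0.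
Qed.

(* The image of the component is open in [B] since polynomials are open maps, and closed in [B]
   since near any [y] in [B] all preimages are close to the finitely many roots of [p - y]. *)
Lemma component_surj p B x y : (1 < size p)%N -> open B -> connected B ->
  B p.[x] -> B y -> exists2 w, connected_component [set z | B p.[z]] x w & p.[w] = y.
Proof.
move=> p1 oB cB Bx By; set P := [set z | B p.[z]]; set A := connected_component P x.
have oP : open P by exact: open_preimage.
have oA : open A by exact: open_component.
have Ax : A x by exact: connected_component_refl.
have [/= fA _] : let I := [set p.[z] | z in A] in B `<=` I /\ True.
  split=> //; pose V := [set u | B u /\ forall w, p.[w] = u -> ~ A w].
  apply: (@connected_open_split _ B _ V p.[x]) => //.
  - apply/open_normcP => _ [z Az <-].
    have [e e0 eA] := (open_normcP A).1 oA z Az.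
    exists (N (lead_coef p) * e ^+ (size p).-1); first exact: lead_pow_gt0.
    move=> u; rewrite /disc/= normcB => /near_preimage[]// w <- zw.
    by exists w => //; apply: eA; rewrite /disc/= normcB.
  - apply/open_normcP => u [Bu uA].
    have [e e0 eP] : exists2 e, 0 < e &
        forall w, w \in rootseq (p - u%:P) -> disc w e `&` A = set0.
      have : {in rootseq (p - u%:P), forall w, p.[w] = u}.
        move=> w; rewrite mem_rootseq ?root_subC; first by move/eqP.
        by apply: nonconst_neq0; rewrite size_subC.
      elim: (rootseq _) => [_|w s IH ws]; first by exists 1.
      have [|e e0 eP] := IH.
        by move=> v vs; apply: ws; rewrite in_cons vs orbT.
      have pw : p.[w] = u by apply: ws; rewrite mem_head.
      have [|d d0 dP] := (open_normcP P).1 oP w.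
        by rewrite /P/= pw.
      exists (Num.min e d); first by rewrite lt_min e0.
      move=> v; rewrite in_cons => /orP[/eqP->|/eP eV].
        rewrite -subset0 => t []; rewrite /disc/= lt_min => /andP[_ td] At.
        apply: (uA w pw).
        have h := component_absorb (@connected_disc R w d) dP td At.
        by apply: h; exact: disc_center.
      rewrite -subset0 => t []; rewrite /disc/= lt_min => /andP[te _] At.
      by have : (disc v e `&` A) t by []; rewrite eV.
    have [d d0 dB] := (open_normcP B).1 oB u Bu.
    exists (Num.min d (N (lead_coef p) * e ^+ (size p).-1)).
      by rewrite lt_min d0 lead_pow_gt0.
    move=> v; rewrite /disc/= lt_min => /andP[vd ve]; split; first exact: dB.
    move=> w pw Aw; move: ve; rewrite -pw => /near_preimage[]// t pt wt.
    have : (disc t e `&` A) w by [].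
    rewrite eP// mem_rootseq ?root_subC ?pt//.
    by apply: nonconst_neq0; rewrite size_subC.
  - move=> u Bu; have [[w Aw pw]|h] := pselect (exists2 w, A w & p.[w] = u).
      by left; exists w.
    by right; split=> // w pw Aw; apply: h; exists w.
  - by rewrite -subset0 => u [[_ [w Aw <-]] [_ /(_ w erefl)]].
  - by exists x.
by have [w Aw wy] := fA y By; exists w.
Qed.

End PolynomialMaps.

(** * Local structure of lemniscates *)

Section LocalStructure.
Variable R : realType.
Local Notation C := R[i].
Local Notation N := (@ComplexField.Normc.normc R).
Implicit Types (p q F : {poly C}) (x y z w c : C) (A B U V Y : set C) (e r b : R).

Lemma count_rootseq p c : p != 0 -> count_mem c (rootseq p) = mup c p.
Proof.
move=> p0; rewrite {2}(poly_rootseq p) -mul_polyC mupMr.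
  by rewrite mu_prod_XsubC.
by rewrite rootC lead_coef_eq0.
Qed.

Lemma size_derivC p : size p^`() = (size p).-1.
Proof.
have [lep1|lt1p] := leqP (size p) 1.
  by rewrite {1}[p]size1_polyC // derivC size_poly0 -subn1 (eqnP lep1).
rewrite size_poly_eq // mulrn_eq0 -subn2 -subSn // subn2.
by rewrite lead_coef_eq0 -size_poly_eq0 -(subnKC lt1p).
Qed.

Lemma deriv_neq0 p : (1 < size p)%N -> p^`() != 0.
Proof. by move=> p1; rewrite -size_poly_gt0 size_derivC; case: (size p) p1 => [|[]]. Qed.

Lemma mup_factor p c : p != 0 ->
  exists2 u : {poly C}, ~~ root u c & p = u * ('X - c%:P) ^+ mup c p.
Proof.
move=> p0; have [m [u]] := multiplicity_XsubC p c; rewrite p0 /= => uc pE.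
by exists u => //; rewrite {2}pE mupMr// mup_XsubCX eqxx.
Qed.

Lemma mup_deriv p c : p != 0 -> root p c -> mup c p = (mup c p^`()).+1.
Proof.
move=> p0 pc; have [u uc pE] := mup_factor c p0.
have : (0 < mup c p)%N by rewrite -XsubC_dvd// dvdp_XsubCl.
case mE : (mup c p) => [//|k] _; congr S; rewrite mE in pE.
have -> : p^`() = (u^`() * ('X - c%:P) + u *+ k.+1) * ('X - c%:P) ^+ k.
  rewrite pE derivM deriv_exp derivXsubC mul1r exprS /=; ring.
rewrite mupMr ?mup_XsubCX ?eqxx// /root hornerD hornerM hornerXsubC.
by rewrite subrr mulr0 add0r hornerMn mulrn_eq0.
Qed.

Lemma ler_prod_pow (s : seq C) (f : C -> R) b :
  (forall x, x \in s -> 0 <= f x <= b) -> \prod_(x <- s) f x <= b ^+ size s.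
Proof.
elim: s => [_|x s IH sP]; first by rewrite big_nil expr0.
have {}IH : \prod_(y <- s) f y <= b ^+ size s.
  by apply: IH => y ys; apply: sP; rewrite in_cons ys orbT.
have /andP[x0 xb] := sP x (mem_head _ _).
rewrite big_cons /= exprS ler_pM// big_seq prodr_ge0// => y ys.
by have /andP[] : 0 <= f y <= b by apply: sP; rewrite in_cons ys orbT.
Qed.

(* At distance [t] from [c], |F - F(c)| is at least of order t^(m+1), whereas m + 2 roots of
   [F - v] within [t] of [c] would make |F - v| of order t^(m+2). *)
Lemma few_near_roots F c : (1 < size F)%N ->
  exists2 e, 0 < e & forall v (s : seq C), uniq s ->
    (forall x, x \in s -> F.[x] = v /\ N (x - c) < e) ->
    (size s <= (mup c F^`()).+1)%N.
Proof.
move=> F1; set m := mup c _.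
pose G := F - F.[c]%:P.
have G0 : G != 0 by apply: nonconst_neq0; rewrite size_subC.
have Gc : root G c by rewrite root_subC.
have mG : mup c G = m.+1 by rewrite mup_deriv// /m derivB derivC subr0.
have [u uc GE] := mup_factor c G0; rewrite mG in GE.
clearbody m.
pose mu := N u.[c] / 2.
have mu0 : 0 < mu by rewrite divr_gt0// normc_gt0.
have [d1 d10 d1P] := horner_cont u c mu0.
have [d2 d20 d2P] := horner_cont F c (@ltr01 R).
have [rho rhoP] := bounded_preimage (N F.[c] + 1) F1.
pose B := `|rho| + N c + 2.
have B1 : 1 <= B by have := normc_ge0 c; have := normr_ge0 rho; rewrite /B; lra.
pose BB := N (lead_coef F) * B ^+ (size F) + 1.
have BB0 : 0 < BB.
  by rewrite ltr_wpDl// mulr_ge0 ?normc_ge0// exprn_ge0// (le_trans ler01).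
(* At distance [t] from [c], |F - F(c)| is at least mu t^(m+1), while m + 2 roots of [F - v] near
   [c] make |F - v| at most BB (2t)^(m+2), which the last bound on [t] makes at most mu t^(m+1) / 2.
   [B] bounds the distance from the test point to the remaining roots. *)
pose t : R := Num.min (Num.min 1 (d1 / 2)) (mu / (2 ^+ m.+3 * BB)).
have p20 : 0 < (2 : R) ^+ m.+3 by rewrite exprn_gt0.
have t0 : 0 < t.
  rewrite lt_min; apply/andP; split; first by rewrite lt_min ltr01 divr_gt0.
  by apply: divr_gt0 => //; exact: mulr_gt0.
have [t1 td1 tmu] : [/\ t <= 1, t < d1 & t * (2 ^+ m.+3 * BB) <= mu].
  have : t <= 1 by rewrite /t !ge_min lexx.
  have : t <= d1 / 2 by rewrite /t !ge_min lexx orbT.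
  have : t <= mu / (2 ^+ m.+3 * BB) by rewrite {1}/t !ge_min lexx orbT.
  rewrite ler_pdivlMr; last exact: mulr_gt0.
  move=> h1 h2 h3; split=> //.
  by apply: (le_lt_trans h2); lra.
clearbody t.
have nu0 : 0 < mu * t ^+ m.+1 / 2 by rewrite divr_gt0// mulr_gt0// exprn_gt0.
have [d3 d30 d3P] := horner_cont F c nu0.
exists (Num.min t (Num.min d2 d3)); first by rewrite !lt_min t0 d20.
move=> v s us sP; rewrite leqNgt; apply/negP => ms.
pose z : C := c + t%:C.
have zc : N (z - c) = t by rewrite /z addrC addKr normc_real ger0_norm// ltW.
have [x0 x0s] : exists x0, x0 \in s.
  by case: (s) ms => // x0 s' _; exists x0; rewrite mem_head.
have [Fx0 x0c] := sP _ x0s; rewrite !lt_min in x0c.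
have /and3P[x0t x0d2 x0d3] := x0c.
have vF1 : N (v - F.[c]) < 1 by rewrite -Fx0; apply: d2P.
have vFnu : N (v - F.[c]) < mu * t ^+ m.+1 / 2 by rewrite -Fx0; apply: d3P.
have low : mu * t ^+ m.+1 <= N (F.[z] - F.[c]).
  have -> : F.[z] - F.[c] = u.[z] * (z - c) ^+ m.+1.
    have : G.[z] = F.[z] - F.[c] by rewrite !hornerE.
    by rewrite GE => <-; rewrite !hornerE.
  rewrite normcM normcX zc ler_wpM2r ?exprn_ge0 ?(ltW t0)//.
  have zd1 : N (z - c) < d1 by rewrite zc.
  have := d1P z zd1; have := normc_triangle u.[z] u.[c] 0.
  rewrite !subr0 (normcB u.[c]) /mu; lra.
pose P := F - v%:P.
have P0 : P != 0 by apply: nonconst_neq0; rewrite size_subC.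
have sub : {subset s <= rootseq P}.
  by move=> x xs; rewrite mem_rootseq// root_subC; case: (sP x xs) => ->.
have Bfac x : x \in rootseq P -> N (z - x) <= B.
  rewrite mem_rootseq// root_subC => /eqP Px.
  have := rhoP x; rewrite Px => /(_ _)h.
  have := normcD (v - F.[c]) F.[c]; rewrite subrK => hv.
  have {}h : N x <= rho by apply: h; lra.
  have := normc_triangle c z x; rewrite zc; have := normc_triangle 0 c x.
  rewrite subr0 sub0r normcN; have := ler_norm rho; rewrite /B; lra.
have sfac x : x \in s -> N (z - x) <= 2 * t.
  move=> xs; have [_] := sP _ xs; rewrite !lt_min => /and3P[xt _ _].
  have := normc_triangle c z x; rewrite zc (normcB c); lra.
have up : N (F.[z] - v) <= BB * (2 * t) ^+ m.+2.
  have -> : F.[z] - v = P.[z] by rewrite !hornerE.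
  rewrite normc_horner lead_coef_subC//.
  pose s1 := take m.+2 s.
  have us1 : uniq s1 by exact: take_uniq.
  have ss1 : size s1 = m.+2 by rewrite size_takel.
  have sub1 : {subset s1 <= rootseq P} by move=> x /mem_take; exact: sub.
  have [rest restP] : exists rest, perm_eq (rootseq P) (s1 ++ rest).
    have [x|s2 s2P s12] := (count_subseqP s1 (rootseq P)).1.
      rewrite count_uniq_mem//; case: (boolP (x \in s1)) => //= /sub1 xr.
      by rewrite lt0n -leqn0 -ltnNge -has_count has_pred1.
    have [s3 s3P] := perm_to_subseq s2P; exists s3.
    by apply: (perm_trans s3P); rewrite perm_cat2r perm_sym.
  have szr : (size rest <= size F)%N.
    have := perm_size restP; rewrite size_cat size_rootseq// size_subC// => h.
    by rewrite (leq_trans _ (leq_pred _))// h leq_addl.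
  rewrite (perm_big _ restP)/= big_cat /= mulrCA mulrC.
  apply: ler_pM.
  - by rewrite mulr_ge0 ?normc_ge0// prodr_ge0// => x _; exact: normc_ge0.
  - by rewrite prodr_ge0// => x _; exact: normc_ge0.
  - rewrite /BB; apply: (@le_trans _ _ (N (lead_coef F) * B ^+ size F)); last first.
      by rewrite lerDl.
    rewrite ler_wpM2l ?normc_ge0//.
    apply: (@le_trans _ _ (B ^+ size rest)); last by rewrite ler_weXn2l.
    apply: ler_prod_pow => x xr; rewrite normc_ge0 Bfac//.
    by rewrite (perm_mem restP) mem_cat xr orbT.
  - rewrite -ss1; apply: ler_prod_pow => x xs; rewrite normc_ge0 sfac//.
    exact: mem_take xs.
have : BB * (2 * t) ^+ m.+2 <= mu * t ^+ m.+1 / 2.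
  have -> : BB * (2 * t) ^+ m.+2 = t * (2 ^+ m.+3 * BB) / 2 * t ^+ m.+1.
    by rewrite exprMn (exprS 2 m.+2) (exprS t m.+1); field.
  rewrite (mulrAC mu).
  apply: ler_wpM2r; first by apply: exprn_ge0; exact: ltW.
  by apply: ler_wpM2r; rewrite ?invr_ge0.
move: up low vFnu; have := normc_triangle v F.[z] F.[c].
move: (mu * _) (BB * _) (N _) (N _) (N _) => a b n1 n2 n3; lra.
Qed.

Definition lemn F r : set C := [set z | N F.[z] < r].

(* A number of components is bounded through lists of pairwise unconnected points, which
   avoids quotients. *)
Fixpoint indep (E : C -> C -> Prop) (s : seq C) : Prop :=
  if s is x :: s' then (forall y, y \in s' -> ~ E x y) /\ indep E s' else True.

Lemma indep_map (E E' : C -> C -> Prop) (f : C -> C) s :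
  (forall x y, x \in s -> y \in s -> E' (f x) (f y) -> E x y) ->
  indep E s -> indep E' [seq f x | x <- s].
Proof.
elim: s => [//|x s IH] EE' /= [xs ss]; split.
  move=> _ /mapP[y ys ->] /EE' h; apply: (xs y ys); apply: h; first exact: mem_head.
  by rewrite in_cons ys orbT.
by apply: IH => // y z ys zs; apply: EE'; rewrite in_cons ?ys ?zs orbT.
Qed.

Lemma indep_uniq (E : C -> C -> Prop) s :
  (forall x, x \in s -> E x x) -> indep E s -> uniq s.
Proof.
elim: s => [//|x s IH] Er /= [xs ss]; rewrite IH// ?andbT.
  by apply/negP => xs'; apply: (xs x xs'); apply: Er; rewrite mem_head.
by move=> y ys; apply: Er; rewrite in_cons ys orbT.
Qed.

Lemma indep_filter (E : C -> C -> Prop) (a : pred C) s :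
  indep E s -> indep E [seq x <- s | a x].
Proof.
elim: s => [//|x s IH] /= [xs ss]; case: ifP => _; last exact: IH.
by split; [move=> y; rewrite mem_filter => /andP[_ /xs]|exact: IH].
Qed.

Lemma open_lemn F r : open (lemn F r).
Proof.
have -> : lemn F r = [set z | disc 0 r F.[z]].
  by apply/seteqP; split=> z; rewrite /lemn /disc/= subr0.
by apply: open_preimage; exact: open_disc.
Qed.

(* Near [c], each component of {|F| < |F(c)|} covers a convex set of values, hence contains a
   root of [F - v'] for one fixed [v'] close to [F(c)]. *)
Lemma few_near_components F c : (1 < size F)%N -> 0 < N F.[c] ->
  exists2 e, 0 < e & forall s,
    indep (connected_component (lemn F (N F.[c]))) s ->
    (forall x, x \in s -> lemn F (N F.[c]) x /\ N (x - c) < e) ->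
    (size s <= (mup c F^`()).+1)%N.
Proof.
move=> F1; set v := F.[c]; set r := N v => r0.
have [e0 e00 e0P] := few_near_roots c F1.
have P0 : F - v%:P != 0 by apply: nonconst_neq0; rewrite size_subC.
have [e1 [e10 e1e e1P]] : exists e1 : R, [/\ 0 < e1, e1 <= e0 &
    forall x, F.[x] = v -> x = c \/ 2 * e1 <= N (x - c)].
  suff [e1 [e10 e1e e1P]] : exists e1 : R, [/\ 0 < e1, e1 <= e0 &
    forall x, x \in rootseq (F - v%:P) -> x = c \/ 2 * e1 <= N (x - c)].
    exists e1; split=> // x Fx; apply: e1P.
    by rewrite mem_rootseq// root_subC Fx.
  elim: (rootseq _) => [|x s [e1 [e10 e1e e1P]]]; first by exists e0.
  have [xc|xc] := eqVneq x c.
    exists e1; split=> // y; rewrite in_cons => /orP[/eqP->|/e1P//].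
    by left.
  exists (Num.min e1 (N (x - c) / 2)); split.
  - by rewrite lt_min e10 divr_gt0// normc_gt0 subr_eq0.
  - by rewrite ge_min e1e.
  move=> y; rewrite in_cons => /orP[/eqP->|/e1P[->|h]]; [right|by left|right].
    rewrite mulrC -ler_pdivlMr// ge_min lexx orbT//.
  rewrite (le_trans _ h)// ler_pM2l// ge_min lexx//.
(* Values within [eta] of [v] are taken only within e1 / 2 of a root of [F - v], so no such point is
   at distance exactly [e1] from [c]. *)
pose eta := N (lead_coef F) * (e1 / 2) ^+ (size F).-1.
have eta0 : 0 < eta by apply: lead_pow_gt0 => //; rewrite divr_gt0.
have sep z : N (F.[z] - v) < eta -> N (z - c) < e1 \/ e1 < N (z - c).
  move=> /near_preimage[||x Fx zx]//; first by rewrite divr_gt0.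
  have [xc|h] := e1P x Fx; first by left; rewrite -xc (lt_trans zx)//; lra.
  by right; have := normc_triangle z x c; rewrite (normcB x z); lra.
have [d d0 dP] := horner_cont F c eta0.
exists (Num.min d e1); first by rewrite lt_min d0.
move=> s ind sP.
pose W := disc 0 r `&` disc v eta.
have oW : open W by apply: openI; exact: open_disc.
have cW : connected W.
  apply: connected_convex => x y t [x1 x2] [y1 y2] t01.
  by split; apply: disc_convex.
pose t : R := Num.min (1 / 2) (eta / (2 * r)).
have t0 : 0 < t by rewrite lt_min !divr_gt0// mulr_gt0.
have [t1 tr] : t <= 1 / 2 /\ t * r <= eta / 2.
  split; first by rewrite ge_min lexx.
  have -> : eta / 2 = eta / (2 * r) * r by field; rewrite gt_eqF.
  by rewrite ler_pM2r// ge_min lexx orbT.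
clearbody t.
(* A common target on the segment from 0 to [v], inside the convex set [W]; each component takes
   this value within [e1] of [c]. *)
pose v' := (1 - t)%:C * v.
have Wv' : W v'.
  split; rewrite /disc/=.
    rewrite subr0 normcM normc_real ger0_norm ?subr_ge0; last by lra.
    by rewrite -/r mulrBl mul1r ltrBlDr ltrDl mulr_gt0.
  have -> : v' - v = (- t)%:C * v by rewrite /v' rmorphB/= rmorph1 rmorphN/=; ring.
  rewrite normcM normc_real normrN ger0_norm ?(ltW t0)// -/r; lra.
have WF x : x \in s -> W F.[x].
  move=> /sP[xr]; rewrite lt_min => /andP[xd _]; split.
    by rewrite /disc/= subr0.
  exact: dP.
have /choice[f fP] : forall x, exists y, x \in s ->
    connected_component [set z | W F.[z]] x y /\ F.[y] = v'.
  move=> x; have [xs|_] := boolP (x \in s); last by exists x.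
  by have [y xy Fy] := component_surj F1 oW cW (WF x xs) Wv'; exists y.
have Wsub : [set z | W F.[z]] `<=` lemn F r.
  by move=> z [+ _]; rewrite /disc/= subr0.
have flemn x : x \in s -> connected_component (lemn F r) x (f x).
  move=> xs; have [[Y [Yx YW cY] Yf] _] := fP x xs.
  by exists Y => //; split=> //; exact: subset_trans Wsub.
have us : uniq [seq f x | x <- s].
  apply: (@indep_uniq (connected_component (lemn F r))).
    move=> _ /mapP[x xs ->]; apply: connected_component_refl.
    exact: connected_component_sub (flemn x xs).
  apply: indep_map ind => x y xs ys fxy.
  apply: (connected_component_trans (flemn x xs)).
  apply: (connected_component_trans fxy).
  by apply: connected_component_sym; exact: flemn.
rewrite -(size_map f s); apply: (e0P v') => // _ /mapP[x xs ->].
have [[Y [Yx YW cY] Yf] Ff] := fP x xs; split=> //.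
have /(_ (f x) Yf) h : Y `<=` disc c e1.
  apply: (@connected_open_split _ Y _ [set z | e1 < N (z - c)] x) => //.
  - exact: open_disc.
  - apply/open_normcP => z /= zc; exists (N (z - c) - e1); first by rewrite subr_gt0.
    move=> w; rewrite /disc/= => wz; have := normc_triangle w z c.
    rewrite (normcB z w); lra.
  - by move=> z /YW [_] /sep.
  - rewrite -subset0 => z [[_ h1] h2]; move: h1 h2; rewrite /disc/=; lra.
  - by have [_] := sP x xs; rewrite lt_min => /andP[].
exact: lt_le_trans h e1e.
Qed.

End LocalStructure.

(** * Merging of components at a critical level *)

Section Merging.
Variable R : realType.
Local Notation C := R[i].
Local Notation N := (@ComplexField.Normc.normc R).
Local Notation comp := (@connected_component C).
Implicit Types (p q F : {poly C}) (x y z w c : C) (A B U V Y : set C) (e r t b : R).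

Definition clemn F r : set C := [set z | N F.[z] <= r].

Lemma comp_mono A B x : A `<=` B -> comp A x `<=` comp B x.
Proof.
by move=> AB y [Y [Yx YA cY] Yy]; exists Y => //; split=> //; exact: subset_trans AB.
Qed.

Lemma lemn_mono F r t : r <= t -> lemn F r `<=` lemn F t.
Proof. by move=> rt z /= /lt_le_trans; apply. Qed.

Lemma lemn_clemn F r : lemn F r `<=` clemn F r.
Proof. by move=> z /ltW. Qed.

Lemma clemn_lemn F r t : r < t -> clemn F r `<=` lemn F t.
Proof. by move=> rt z /= /le_lt_trans; apply. Qed.

Lemma clemn_mono F r t : r <= t -> clemn F r `<=` clemn F t.
Proof. by move=> rt z /= /le_trans; apply. Qed.

Lemma closed_clemn F r : closed (clemn F r).
Proof.
apply/closed_normcP => z zF; rewrite /clemn/= leNgt; apply/negP => rz.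
have d0 : 0 < N F.[z] - r by rewrite subr_gt0.
have [d d1 dP] := horner_cont F z d0.
have [w wr wz] := zF d d1; rewrite /clemn/= in wr.
have := dP w wz; have := normc_triangle F.[w] F.[z] 0.
rewrite !subr0 (normcB F.[z]); lra.
Qed.

(** Move the value [F.[z]] slightly towards 0 and lift it to a point near [z]. *)
Lemma clemn_closure F r z : (1 < size F)%N -> 0 < r -> clemn F r z ->
  closure (lemn F r) z.
Proof.
move=> F1 r0 /= zr; apply/closure_normcP => e e0.
pose eta := N (lead_coef F) * e ^+ (size F).-1.
have eta0 : 0 < eta by exact: lead_pow_gt0.
pose t : R := Num.min (1 / 2) (eta / (2 * r)).
have t0 : 0 < t by rewrite lt_min !divr_gt0// mulr_gt0.
have [t1 tr] : t <= 1 / 2 /\ t * r <= eta / 2.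
  split; first by rewrite ge_min lexx.
  have -> : eta / 2 = eta / (2 * r) * r by field; rewrite gt_eqF.
  by rewrite ler_pM2r// ge_min lexx orbT.
clearbody t.
have [||w Fw zw] := @near_preimage _ F ((1 - t)%:C * F.[z]) z e F1 => //.
  have -> : F.[z] - (1 - t)%:C * F.[z] = t%:C * F.[z].
    by rewrite rmorphB/= rmorph1; ring.
  rewrite normcM normc_real ger0_norm ?(ltW t0)// -/eta.
  have : t * N F.[z] <= t * r by rewrite ler_pM2l.
  lra.
exists w; last by rewrite normcB.
rewrite /lemn/= Fw normcM normc_real ger0_norm ?subr_ge0; last by lra.
have : (1 - t) * N F.[z] <= (1 - t) * r by rewrite ler_pM2l// subr_gt0; lra.
have : 0 < t * r by exact: mulr_gt0.
lra.
Qed.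

Lemma zero_in_component F r x : (1 < size F)%N -> lemn F r x ->
  exists2 y, y \in rootseq F & comp (lemn F r) x y.
Proof.
move=> F1 xr; have r0 : 0 < r := le_lt_trans (normc_ge0 _) xr.
have [||y xy Fy] := @component_surj _ F (disc 0 r) x 0 F1 (@open_disc R 0 r)
  (@connected_disc R 0 r).
- by rewrite /disc/= subr0.
- exact: disc_center.
exists y; first by rewrite mem_rootseq ?nonconst_neq0//; apply/eqP.
by apply: comp_mono xy => z; rewrite /disc/= subr0.
Qed.

(** * Gluing components at the critical points of one level *)

Section Level.
Variables (F : {poly C}) (r : R) (A : set C).
Hypotheses (F1 : (1 < size F)%N) (r0 : 0 < r).
(** Components of {|F| < T} with T > r have this property, so the count can be localized to one of
    them. *)
Hypothesis A_reg : forall Y x, connected Y -> Y `<=` clemn F r -> Y x -> A x -> Y `<=` A.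
Local Notation L0 := (comp (lemn F r)).

(* Components of {|F| < r} glued together at the points of [cs] to which they are adherent. *)
Fixpoint link (cs : seq C) x y : Prop :=
  if cs is c :: cs' then
    link cs' x y \/ (exists2 z, link cs' x z & closure (L0 z) c) /\
                    (exists2 z, link cs' y z & closure (L0 z) c)
  else L0 x y.

Lemma link_of_comp cs x y : L0 x y -> link cs x y.
Proof. by elim: cs => [//|c cs IH] xy /=; left; exact: IH. Qed.

Lemma link_sym cs x y : link cs x y -> link cs y x.
Proof.
elim: cs => [|c cs IH] /=; first exact: connected_component_sym.
by move=> [/IH|[]]; [left|right].
Qed.

Lemma link_trans cs y x z : link cs x y -> link cs y z -> link cs x z.
Proof.
elim: cs x y z => [|c cs IH] x y z /=; first exact: connected_component_trans.
move=> [xy|[xc yc]] [yz|[yc' zc]].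
- by left; exact: IH yz.
- by right; split=> //; case: yc' => w yw wc; exists w => //; exact: IH yw.
- right; split=> //; case: yc => w yw wc; exists w => //.
  by apply: IH yw; exact: link_sym.
- by right.
Qed.

Lemma link_at cs c x y : c \in cs -> lemn F r x -> lemn F r y ->
  closure (L0 x) c -> closure (L0 y) c -> link cs x y.
Proof.
move=> + xr yr xc yc; elim: cs => [//|c' cs IH].
rewrite in_cons => /orP[/eqP<-|/IH h] /=; last by left.
right; split.
  by exists x => //; apply: link_of_comp; exact: connected_component_refl.
by exists y => //; apply: link_of_comp; exact: connected_component_refl.
Qed.

Lemma indep_neq (E : C -> C -> Prop) s x y :
  (forall u v, E u v -> E v u) -> indep E s -> x \in s -> y \in s -> x != y ->
  ~ E x y.
Proof.
move=> Esym; elim: s => [//|z s IH] /= [zs ss].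
rewrite !in_cons => /orP[/eqP->|xs] /orP[/eqP->|ys]; rewrite ?eqxx//.
- by move=> _; exact: zs.
- by move=> _ /Esym; exact: zs.
- exact: IH.
Qed.

(** Linking at [c] merges only the classes adherent to [c], of which there are at most m + 1 by
    [few_near_components], m being the multiplicity; keeping one of them loses at most m points. *)
Lemma link_step cs c s : N F.[c] = r -> indep (link cs) s ->
  (forall x, x \in s -> lemn F r x) ->
  exists s', [/\ {subset s' <= s}, indep (link (c :: cs)) s' &
    (size s <= size s' + mup c F^`())%N].
Proof.
move=> Fc ind sr.
have [|e e0 eP] := @few_near_components _ F c F1; first by rewrite Fc.
rewrite Fc in eP.
pose adh x := `[< exists2 z, link cs x z & closure (L0 z) c >].
pose s1 := [seq x <- s | adh x]; pose s2 := [seq x <- s | ~~ adh x].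
have ssz : size s = (size s1 + size s2)%N.
  by rewrite -(count_predC adh s) !size_filter.
have /choice[f fP] : forall x, exists w, x \in s1 ->
    [/\ lemn F r w, N (w - c) < e & link cs x w].
  move=> x; have [|_] := boolP (x \in s1); last by exists x.
  rewrite mem_filter => /andP[/asboolP[z xz /closure_normcP/(_ e e0)[w zw wc]] _].
  exists w => _; split=> //; first exact: connected_component_sub zw.
  by apply: link_trans xz _; exact: link_of_comp.
have s1m : (size s1 <= (mup c F^`()).+1)%N.
  rewrite -(size_map f); apply: eP.
    apply: (@indep_map _ (link cs)); last by apply: indep_filter.
    move=> x y xs ys fxy; have [_ _ xf] := fP x xs; have [_ _ yf] := fP y ys.
    apply: (link_trans xf); apply: (link_trans (link_of_comp _ fxy)).
    exact: link_sym.
  by move=> _ /mapP[x xs ->]; case: (fP x xs).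
have ind2 : indep (link (c :: cs)) s2.
  rewrite -(map_id s2); apply: (@indep_map _ (link cs)); last by apply: indep_filter.
  move=> x y; rewrite mem_filter => /andP[/asboolPn xc _] _ /= [//|[xc' _]].
  by [].
case s1E : s1 => [|x0 s1'].
  exists s2; split=> //.
    by move=> x; rewrite mem_filter => /andP[].
  by rewrite ssz s1E /= leq_addr.
have x0s1 : x0 \in s1 by rewrite s1E mem_head.
have x0s : x0 \in s by move: x0s1; rewrite mem_filter => /andP[].
exists (x0 :: s2); split.
- by move=> x; rewrite in_cons => /orP[/eqP->//|]; rewrite mem_filter => /andP[].
- split=> // y; rewrite mem_filter => /andP[yc ys].
  have /asboolPn yc' := yc.
  move=> /= [|[_]//]; apply: (indep_neq (@link_sym cs) ind) => //.
  apply: contraNneq yc => <-.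
  by move: x0s1; rewrite mem_filter => /andP[].
- by rewrite ssz /= addSnnS [leqRHS]addnC leq_add2r.
Qed.

Lemma link_steps cs s : (forall c, c \in cs -> N F.[c] = r) -> indep L0 s ->
  (forall x, x \in s -> lemn F r x) ->
  exists s', [/\ {subset s' <= s}, indep (link cs) s' &
    (size s <= size s' + \sum_(c <- cs) mup c F^`())%N].
Proof.
move=> + ind sr; elim: cs => [_|c cs IH csP].
  by exists s; split=> //; rewrite big_nil addn0.
have [|s1 [sub1 ind1 sz1]] := IH; first by move=> y yc; apply: csP; rewrite in_cons yc orbT.
have [|||s2 [sub2 ind2 sz2]] := @link_step cs c s1 => //.
- by apply: csP; rewrite mem_head.
- by move=> x /sub1/sr.
exists s2; split=> //; first by move=> x /sub2/sub1.
rewrite big_cons addnA; apply: (leq_trans sz1).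
by rewrite leq_add2r.
Qed.

Lemma closed_finite_union (Q : C -> Prop) (f : C -> set C) (s : seq C) :
  (forall x, closed (f x)) ->
  closed [set w | exists x, [/\ x \in s, Q x & f x w]].
Proof.
move=> clf; have -> : [set w | exists x, [/\ x \in s, Q x & f x w]] =
    \bigcup_(x in [set` s] `&` Q) f x.
  by apply/seteqP; split=> [w [x [xs Qx fx]]|w [x [xs Qx] fx]]; exists x.
apply: closed_bigcup => //; apply: sub_finite_set (finite_seq s).
by move=> x [].
Qed.

(* The closures of the components linked to [x] and of the other ones form two closed sets
   covering the component of {|F| <= r}; by [few_near_components] they can only meet at a
   critical point, where they would be linked. *)
Lemma link_closed cs x y : (forall c, A c -> N F.[c] = r -> root F^`() c -> c \in cs) ->
  lemn F r x -> lemn F r y -> A x -> A y -> comp (clemn F r) x y -> link cs x y.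
Proof.
move=> csP xr yr Ax Ay [Y [Yx Yr cY] Yy].
have YA : Y `<=` A by exact: A_reg Yx Ax.
pose P := [set w | exists z, [/\ z \in rootseq F, link cs x z & closure (L0 z) w]].
pose P' := [set w | exists z, [/\ z \in rootseq F, ~ link cs x z & closure (L0 z) w]].
have cP : closed P by apply: closed_finite_union => z; exact: closed_closure.
have cP' : closed P' by apply: closed_finite_union => z; exact: closed_closure.
have zr z : z \in rootseq F -> lemn F r z.
  by rewrite mem_rootseq ?nonconst_neq0// => /eqP Fz; rewrite /lemn/= Fz normc0.
have PP w : Y w -> P w -> P' w -> False.
  move=> Yw [z [zF xz zw]] [z' [z'F xz' z'w]]; apply: xz'.
  apply: (link_trans xz).
  have := Yr w Yw; rewrite /clemn/= le_eqVlt => /orP[/eqP wr|wr].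
    have [wc|wnc] := boolP (root F^`() w).
      by apply: (@link_at cs w) => //; [apply: csP => //; exact: YA|exact: zr..].
    have [|e e0 eP] := @few_near_components _ F w F1; first by rewrite wr.
    have [u zu uw] := (closure_normcP _ _).1 zw e e0.
    have [u' zu' uw'] := (closure_normcP _ _).1 z'w e e0.
    rewrite wr mupNroot// in eP.
    have [h|nuu'] := pselect (L0 u u').
      apply: link_of_comp; apply: (connected_component_trans zu).
      by apply: (connected_component_trans h); exact: connected_component_sym.
    have /= := eP [:: u; u']; rewrite ltnn => h; exfalso; apply: notF; apply: h.
      by split=> // v; rewrite inE => /eqP ->.
    move=> v; rewrite !inE => /orP[/eqP->|/eqP->].
      by split=> //; exact: connected_component_sub zu.
    by split=> //; exact: connected_component_sub zu'.
  have [e e0 eW] := (open_normcP _).1 (@open_component R _ w (@open_lemn R F r)) w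
    (connected_component_refl (A := lemn F r) wr).
  have [u zu /eW uw] := (closure_normcP _ _).1 zw e e0.
  have [u' zu' /eW uw'] := (closure_normcP _ _).1 z'w e e0.
  apply: link_of_comp; apply: (connected_component_trans zu).
  apply: (connected_component_trans (connected_component_sym uw)).
  by apply: (connected_component_trans uw'); exact: connected_component_sym.
have YPP w : Y w -> P w \/ P' w.
  move=> Yw; suff [z zF zw] : exists2 z, z \in rootseq F & closure (L0 z) w.
    by have [h|h] := pselect (link cs x z); [left|right]; exists z.
  apply: contrapT => h.
  have : forall z, z \in rootseq F -> ~ closure (L0 z) w.
    by move=> z zF zw; apply: h; exists z.
  have := clemn_closure F1 r0 (Yr w Yw); move=> /closure_normcP wcl.
  suff sep (s : seq C) : (forall z, z \in s -> ~ closure (L0 z) w) ->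
      exists2 e, 0 < e & forall z, z \in s -> disc w e `&` L0 z = set0.
    move=> /sep[e e0 eP]; have [u ur uw] := wcl e e0.
    have [z zF uz] := zero_in_component F1 ur.
    have : (disc w e `&` L0 z) u by split=> //; exact: connected_component_sym.
    by rewrite eP.
  elim: s => [_|z s IH zs]; first by exists 1.
  have [|e e0 eP] := IH; first by move=> v vs; apply: zs; rewrite in_cons vs orbT.
  have : ~ closure (L0 z) w by apply: zs; rewrite mem_head.
  move=> nzw; have [d d0 dP] : exists2 d, 0 < d & disc w d `&` L0 z = set0.
    apply: contrapT => h'; apply: nzw; apply/closure_normcP => d d0.
    apply: contrapT => h2; apply: h'; exists d => //.
    by rewrite -subset0 => u [uw zu]; apply: h2; exists u.
  exists (Num.min e d); first by rewrite lt_min e0.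
  move=> v; rewrite in_cons => /orP[/eqP->|vs]; rewrite -subset0 => u [];
    rewrite /disc/= lt_min => /andP[ue ud] vu.
    by have : (disc w d `&` L0 z) u by []; rewrite dP.
  by have : (disc w e `&` L0 v) u by []; rewrite eP.
have own w : lemn F r w -> ~ link cs x w -> P' w.
  move=> wr nw; have [z zF wz] := zero_in_component F1 wr.
  exists z; split=> //.
    by move=> xz; apply: nw; apply: (link_trans xz); apply: link_sym; exact: link_of_comp.
  by apply: subset_closure; exact: connected_component_sym.
have Px : P x.
  have [z zF xz] := zero_in_component F1 xr.
  exists z; split=> //; first exact: link_of_comp.
  by apply: subset_closure; exact: connected_component_sym.
apply: contrapT => /(own y yr) P'y.
suff : Y `<=` ~` P' by move=> /(_ y Yy).
apply: (@connected_open_split R Y (~` P') (~` P) x cY _ _ _ _ Yx).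
- exact: closed_openC.
- exact: closed_openC.
- move=> w Yw; have [Pw|P'w] := YPP w Yw.
    by left => P'w; exact: PP Pw P'w.
  by right => Pw; exact: PP Pw P'w.
- by rewrite -subset0 => w [[Yw nP'] nP]; case: (YPP w Yw).
- by move=> P'x; exact: PP Px P'x.
Qed.

Lemma sum_count_undup (s : seq C) : (\sum_(c <- undup s) count_mem c s)%N = size s.
Proof.
rewrite -(perm_size (perm_count_undup s)) size_flatten sumnE /shape -map_comp big_map.
by apply: eq_bigr => c _; rewrite /= size_nseq.
Qed.

(** Link the components at all critical points of [A] on the level. Each costs at most its
    multiplicity, and by [link_closed] points that are not linked stay in different components of
    {|F| <= r}. *)
Lemma level_step s : indep L0 s -> (forall x, x \in s -> A x /\ lemn F r x) ->
  exists s', [/\ {subset s' <= s}, indep (comp (clemn F r)) s' &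
    (size s <= size s' + count (fun c => `[< A c >] && (N F.[c] == r)) (rootseq F^`()))%N].
Proof.
move=> ind sA; pose a := fun c => `[< A c >] && (N F.[c] == r).
pose cs := undup [seq c <- rootseq F^`() | a c].
have F'0 : F^`() != 0 by exact: deriv_neq0.
have csE c : (c \in cs) = (a c && root F^`() c).
  by rewrite mem_undup mem_filter mem_rootseq.
have [|//||s' [sub ind' sz]] := @link_steps cs s.
- by move=> c; rewrite csE => /andP[/andP[_ /eqP]].
- by move=> x /sA[].
exists s'; split=> //.
  rewrite -(map_id s'); apply: indep_map ind' => x y xs ys xy.
  have [Ax xr] := sA x (sub _ xs); have [Ay yr] := sA y (sub _ ys).
  apply: link_closed => // c Ac cr c'; rewrite csE c' andbT.
  by apply/andP; split; [apply/asboolP|apply/eqP].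
apply: (leq_trans sz); rewrite leq_add2l -size_filter -(sum_count_undup [seq c <- rootseq F^`() | a c]).
rewrite -/cs big_seq [leqRHS]big_seq; apply: leq_sum => c; rewrite csE => /andP[ac _].
rewrite -count_rootseq// count_filter.
by apply: eq_leq; apply: eq_count => z /=; case: eqP => [->|//]; rewrite ac.
Qed.

End Level.
End Merging.

(** * Counting zeros and critical points in lemniscate components *)

Section RiemannHurwitz.
Variable R : realType.
Local Notation C := R[i].
Local Notation N := (@ComplexField.Normc.normc R).
Local Notation comp := (@connected_component C).
Implicit Types (p q F : {poly C}) (x y z w c : C) (A B U V Y : set C) (e r t b : R).

Lemma finite_gap (g : C -> R) (s : seq C) t :
  exists2 d, 0 < d & forall c, c \in s -> t < g c -> t + d <= g c.
Proof.
elim: s => [|c s [d d0 dP]]; first by exists 1.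
have [tc|tc] := ltP t (g c); last first.
  exists d => // c'; rewrite in_cons => /orP[/eqP->|/dP//].
  by move=> /lt_le_trans/(_ tc); rewrite ltxx.
exists (Num.min d (g c - t)); first by rewrite lt_min d0 subr_gt0.
move=> c'; rewrite in_cons -lerBrDl ge_min => /orP[/eqP->|/dP h /h].
  by rewrite lexx orbT.
by rewrite -lerBrDl => ->.
Qed.

(** The components at levels decreasing to [t] have a connected intersection, contained in {|F| <=
    t}. *)
Lemma comp_right_limit F t x y : (1 < size F)%N -> clemn F t x ->
  (forall r, t < r -> comp (lemn F r) x y) -> comp (clemn F t) x y.
Proof.
move=> F1 xt xy; pose u (n : nat) : R := t + n.+1%:R^-1.
have ut n : t < u n by rewrite ltrDl invr_gt0 ltr0Sn.
have uS n : u n.+1 <= u n.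
  by rewrite lerD2l lef_pV2 ?posrE ?ltr0Sn// ler_nat.
pose X n := comp (clemn F (u n)) x.
have [rho rhoP] := bounded_preimage (u 0%N) F1.
have cX : connected (\bigcap_n X n).
  apply: (@connected_bigcap_nested _ X rho).
  - by move=> n; apply: component_closed; exact: closed_clemn.
  - by move=> n; exact: component_connected.
  - by move=> n; apply: comp_mono; exact: clemn_mono.
  - by move=> z /connected_component_sub; exact: rhoP.
exists (\bigcap_n X n).
  split=> //.
    move=> n _; apply: connected_component_refl; apply: clemn_mono xt.
    exact: ltW.
  move=> z zX; rewrite /clemn/= leNgt; apply/negP => tz.
  have d0 : 0 < N F.[z] - t by rewrite subr_gt0.
  have : clemn F (u (Num.truncn (N F.[z] - t)^-1)) z.
    exact: connected_component_sub (zX _ I).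
  rewrite /clemn/= leNgt => /negP; apply.
  rewrite /u -ltrBrDl invf_plt ?posrE ?ltr0Sn//.
  by rewrite truncnS_gt.
move=> n _; apply: comp_mono (xy _ (ut n)); exact: lemn_clemn.
Qed.

Lemma indep_right F t (s : seq C) : (1 < size F)%N ->
  (forall x, x \in s -> clemn F t x) -> indep (comp (clemn F t)) s ->
  exists2 d, 0 < d & forall u, u < t + d -> indep (comp (lemn F u)) s.
Proof.
move=> F1 st ind.
have right2 x y : x \in s -> ~ comp (clemn F t) x y ->
    exists2 d, 0 < d & forall u, u < t + d -> ~ comp (lemn F u) x y.
  move=> xs nxy; apply: contrapT => h; apply: nxy.
  apply: comp_right_limit => // [|v tv]; first exact: st.
  apply: contrapT => nxy; apply: h; exists (v - t); first by rewrite subr_gt0.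
  move=> u; rewrite addrC subrK => uv xy; apply: nxy.
  by apply: comp_mono xy; apply: lemn_mono; exact: ltW.
have right1 x (l : seq C) : x \in s -> (forall y, y \in l -> ~ comp (clemn F t) x y) ->
    exists2 d, 0 < d & forall u y, y \in l -> u < t + d -> ~ comp (lemn F u) x y.
  move=> xs; elim: l => [_|y l IH lP]; first by exists 1.
  have [|d d0 dP] := IH; first by move=> z zl; apply: lP; rewrite in_cons zl orbT.
  have [|e e0 eP] := right2 x y xs; first by apply: lP; rewrite mem_head.
  exists (Num.min d e); first by rewrite lt_min d0.
  move=> u z; rewrite in_cons => /orP[/eqP->|zl] ud.
    by apply: eP; apply: (lt_le_trans ud); rewrite lerD2l ge_min lexx orbT.
  by apply: dP => //; apply: (lt_le_trans ud); rewrite lerD2l ge_min lexx.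
suff h (l : seq C) : {subset l <= s} -> indep (comp (clemn F t)) l ->
    exists2 d, 0 < d & forall u, u < t + d -> indep (comp (lemn F u)) l by exact: h.
elim: l => [_ _|x l IH] /=; first by exists 1.
move=> sub [xl indl].
have [|d d0 dP] := IH _ indl; first by move=> y yl; apply: sub; rewrite in_cons yl orbT.
have [|e e0 eP] := @right1 x l _ xl; first by apply: sub; rewrite mem_head.
exists (Num.min d e); first by rewrite lt_min d0.
move=> u ud; split.
  by move=> y yl; apply: eP => //; apply: (lt_le_trans ud); rewrite lerD2l ge_min lexx orbT.
by apply: dP; apply: (lt_le_trans ud); rewrite lerD2l ge_min lexx.
Qed.

(** The points joined to [x] at some level r < t form an open set whose complement in {|F| < t} is
    open too. *)
Lemma comp_left_limit F t x y : comp (lemn F t) x y ->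
  exists2 r, r < t & comp (lemn F r) x y.
Proof.
move=> [Y [Yx Yt cY] Yy].
pose U := [set w | exists2 r, r < t & comp (lemn F r) x w].
suff : Y `<=` U by move=> /(_ y Yy).
have mid w : lemn F t w -> exists r, [/\ N F.[w] < r & r < t].
  rewrite /lemn/= => wt; exists ((N F.[w] + t) / 2).
  by rewrite midf_lt ?midf_lt//; split; lra.
apply: (@connected_open_split _ Y _ (lemn F t `&` ~` U) x) => //.
- apply/open_normcP => w [r rt xw].
  have [e e0 eP] := (open_normcP _).1 (@open_component R _ x (@open_lemn R F r)) w xw.
  by exists e => // v /eP; exists r.
- apply/open_normcP => w [wt nU].
  have [r [wr rt]] := mid w wt.
  have [e e0 eP] := (open_normcP _).1 (@open_lemn R F r) w wr.
  exists e => // v /[dup] vd /eP vr; split; first by apply: lemn_mono vr; exact: ltW.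
  move=> [r' r't xv]; apply: nU; exists (Num.max r r').
    by rewrite gt_max rt.
  apply: (@component_absorb R _ _ (disc w e) v) => //.
  - exact: connected_disc.
  - by move=> u /eP; apply: lemn_mono; rewrite le_max lexx.
  - by apply: comp_mono xv; apply: lemn_mono; rewrite le_max lexx orbT.
  - exact: disc_center.
- move=> w Yw; have [Uw|nU] := pselect (U w); first by left.
  by right; split=> //; exact: Yt.
- by rewrite -subset0 => w [[_ Uw] [_ nU]].
- have [r [xr rt]] := mid x (Yt x Yx).
  by exists r => //; exact: connected_component_refl.
Qed.

(** Level [r] itself is included: critical points on it have not yet merged components of {|F| <
    r}. *)
Definition crit_above F A r :=
  count (fun c => `[< A c >] && (r <= N F.[c])) (rootseq F^`()).

(* Continuity induction on the level, through the supremum [t] of the levels where the bound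
   fails: if it fails at [t], [level_step] transfers the failure to levels above [t]; if not,
   the partition of the zeros into components does not change just below [t]. *)
Lemma merge F T a0 r (s : seq C) (A := comp (lemn F T) a0) : (1 < size F)%N ->
  0 < r <= T -> indep (comp (lemn F r)) s ->
  (forall x, x \in s -> A x /\ lemn F r x) ->
  (size s <= (crit_above F A r).+1)%N.
Proof.
move=> F1 r0T ind sA; apply: contrapT => bad0.
pose bad r := 0 < r <= T /\ exists s : seq C, [/\ indep (comp (lemn F r)) s,
  forall x, x \in s -> A x /\ lemn F r x & ~ (size s <= (crit_above F A r).+1)%N].
have badr : bad r by split=> //; exists s.
have supB : has_sup bad by split; [exists r|exists T => u [/andP[_ ]]].
pose t := sup bad.
have rt : r <= t by exact: ub_le_sup supB.2 _ badr.
have tT : t <= T by apply: ge_sup; [exists r|move=> u [/andP[]]].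
have t0 : 0 < t by apply: lt_le_trans rt; case/andP: r0T.
have above u : t < u -> ~ bad u.
  by move=> tu /(ub_le_sup supB.2); rewrite leNgt tu.
have AT x : A x -> lemn F T x := @connected_component_sub _ _ _ x.
have [badt|nbadt] := pselect (bad t); last first.
  (* No critical point has its level strictly between t - d1 and t. *)
  have [d1 d10 d1P] := finite_gap (fun c => - N F.[c]) (rootseq F^`()) (- t).
  have left2 x y : exists2 d, 0 < d & forall u, t - d < u ->
      comp (lemn F t) x y -> comp (lemn F u) x y.
    have [/comp_left_limit[v vt xy]|nxy] := pselect (comp (lemn F t) x y).
      exists (t - v); first by rewrite subr_gt0.
      move=> u; rewrite opprB addrC subrK => vu _.
      by apply: comp_mono xy; apply: lemn_mono; exact: ltW.
    by exists 1.
  have left1 x (l : seq C) : exists2 d, 0 < d & forall u y, y \in l -> t - d < u ->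
      comp (lemn F t) x y -> comp (lemn F u) x y.
    elim: l => [|y l [d d0 dP]]; first by exists 1.
    have [e e0 eP] := left2 x y; exists (Num.min d e); first by rewrite lt_min d0.
    move=> u z; rewrite in_cons => /orP[/eqP->|zl] ud.
      by apply: eP; apply: le_lt_trans ud; rewrite lerB// ge_min lexx orbT.
    by apply: dP => //; apply: le_lt_trans ud; rewrite lerB// ge_min lexx.
  have [d2 d20 d2P] : exists2 d, 0 < d & forall u x y, x \in rootseq F ->
      y \in rootseq F -> t - d < u -> comp (lemn F t) x y -> comp (lemn F u) x y.
    suff h (l : seq C) : exists2 d, 0 < d & forall u x y, x \in l ->
      y \in rootseq F -> t - d < u -> comp (lemn F t) x y -> comp (lemn F u) x y.
      exact: h.
    elim: l => [|y l [d d0 dP]]; first by exists 1.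
    have [e e0 eP] := left1 y (rootseq F); exists (Num.min d e); first by rewrite lt_min d0.
    move=> u z v; rewrite in_cons => /orP[/eqP->|zl] vF ud.
      by apply: eP => //; apply: le_lt_trans ud; rewrite lerB// ge_min lexx orbT.
    by apply: dP => //; apply: le_lt_trans ud; rewrite lerB// ge_min lexx.
  have d0 : 0 < Num.min d1 d2 by rewrite lt_min d10.
  have [u [uT [s1 [ind1 s1A big]]] tdu] := sup_adherent d0 supB.
  rewrite -/t in tdu.
  have ut : u < t.
    rewrite lt_neqAle ub_le_sup ?andbT//; last 2 first.
    - exact: supB.2.
    - by split=> //; exists s1.
    apply/eqP => utE; apply: nbadt; rewrite -utE.
    by split=> //; exists s1.
  apply: big.
  (* The points of [s1] depend on the level [u]; moving them to zeros of [F] in their components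
     makes the margin [d2], fixed beforehand for the zeros, apply. *)
  have /choice[f fP] : forall x, exists y, x \in s1 ->
      y \in rootseq F /\ comp (lemn F u) x y.
    move=> x; have [xs|_] := boolP (x \in s1); last by exists x.
    have [y] := zero_in_component F1 (s1A x xs).2.
    by exists y.
  have kE : crit_above F A t = crit_above F A u.
    apply: eq_in_count => c cF; congr (_ && _).
    apply/idP/idP => [tc|uc]; first exact: le_trans (ltW ut) tc.
    rewrite leNgt; apply/negP => ct.
    have := d1P c cF; rewrite ltrN2 => /(_ ct) h.
    have : t - d1 <= t - Num.min d1 d2 by rewrite lerB// ge_min lexx.
    lra.
  rewrite -kE -(size_map f); apply: contrapT => big; apply: nbadt.
  split; first by rewrite t0.
  exists [seq f x | x <- s1]; split=> //.
    apply: indep_map ind1 => x y xs ys fxy.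
    have [xF xf] := fP x xs; have [yF yf] := fP y ys.
    apply: (connected_component_trans xf).
    apply: (connected_component_trans _ (connected_component_sym yf)).
    apply: (d2P _ _ _ _ _ _ fxy) => //.
    by apply: le_lt_trans tdu; rewrite lerB// ge_min lexx orbT.
  move=> _ /mapP[x xs ->]; have [xF xf] := fP x xs; split.
    apply: (connected_component_trans (s1A x xs).1).
    by apply: comp_mono xf; apply: lemn_mono; case/andP: uT.
  by apply: (lemn_mono (ltW ut)); exact: connected_component_sub xf.
have [_ [s1 [ind1 s1A big]]] := badt.
(* At level [T] the set [A] is a single component, so no two of its points are independent and the
   bound cannot fail. *)
have tT' : t < T.
  rewrite lt_neqAle tT andbT; apply/eqP => tTE; apply: big.
  case: s1 ind1 s1A => [//|x [//|y s1]] /= [xs _] s1A; exfalso.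
  apply: (xs y (mem_head _ _)); rewrite tTE.
  have [Ax _] := s1A x (mem_head _ _).
  have [|Ay _] := s1A y; first by rewrite !in_cons eqxx orbT.
  exact: connected_component_trans (connected_component_sym Ax) Ay.
have [|s2 [sub2 ind2 sz2]] := @level_step _ F t A F1 t0 _ s1 ind1 s1A.
  move=> Y x cY Yt Yx Ax; apply: (@component_absorb R _ _ Y x) => //.
  by apply: (subset_trans Yt); exact: clemn_lemn.
have [d1 d10 d1P] := finite_gap (fun c => N F.[c]) (rootseq F^`()) t.
have [d2 d20 d2P] : exists2 d, 0 < d & forall u, u < t + d -> indep (comp (lemn F u)) s2.
  by apply: indep_right => // x /sub2 /s1A[_ /lemn_clemn].
pose u := t + Num.min (T - t) (Num.min d1 d2) / 2.
have m0 : 0 < Num.min (T - t) (Num.min d1 d2) by rewrite !lt_min subr_gt0 tT' d10.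
have [m1 m2 m3] : [/\ Num.min (T - t) (Num.min d1 d2) <= T - t,
    Num.min (T - t) (Num.min d1 d2) <= d1 & Num.min (T - t) (Num.min d1 d2) <= d2].
  by split; rewrite !ge_min lexx ?orbT.
move: (Num.min _ _) m0 m1 m2 m3 @u => m m0 m1 m2 m3 u.
have tu : t < u by rewrite /u; lra.
apply: big; apply: (leq_trans sz2).
have szu : (size s2 <= (crit_above F A u).+1)%N.
  apply: contrapT => big; apply: (above u tu); split.
    by apply/andP; split; [exact: lt_trans tu|rewrite /u; lra].
  exists s2; split=> //; first by apply: d2P; rewrite /u; lra.
  move=> x /sub2/s1A[Ax xt]; split=> //; apply: lemn_mono xt; exact: ltW.
apply: (leq_trans (leq_add szu (leqnn _))); rewrite addSn ltnS.
(* The critical points at or above level [t] are those on it, paid for by [level_step], and those at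
   or above [u]. *)
rewrite /crit_above -count_predUI.
rewrite (@eq_in_count _ _ (fun c => `[< A c >] && (t <= N F.[c]))).
  rewrite -[leqRHS]addn0 leq_add2l leqn0 -leqn0 leqNgt -has_count.
  apply/hasPn => c _ /=; apply/negP => /andP[/andP[_ uc] /andP[_ /eqP ct]].
  by move: uc; rewrite ct leNgt tu.
move=> c cF /=; rewrite -andb_orr; congr (_ && _).
apply/idP/idP => [/orP[uc|/eqP->//]|]; first exact: le_trans (ltW tu) uc.
rewrite le_eqVlt => /orP[/eqP->|tc]; first by rewrite eqxx orbT.
by apply/orP; left; have := d1P c cF tc; rewrite /u; lra.
Qed.

Definition count_in A (s : seq C) := count (fun z => `[< A z >]) s.

Lemma sum_count_uniq (s l : seq C) : uniq s ->
  (\sum_(z <- s) count_mem z l)%N = count (mem s) l.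
Proof.
elim: s => [_|z s IH /= /andP[zs us]].
  by rewrite big_nil; elim: l.
rewrite big_cons IH// -count_predUI [X in (_ + X)%N](_ : _ = 0%N).
  by rewrite addn0; apply: eq_count => y; rewrite /= in_cons.
apply/eqP; rewrite -leqn0 leqNgt -has_count; apply/hasPn => y _ /=.
by apply/negP => /andP[/eqP->]; apply/negP.
Qed.

(** Near level 0 distinct zeros lie in distinct components, so [merge] bounds their number by one
    more than the number of critical points in [A] that are not zeros. A zero of multiplicity k is a
    critical point of multiplicity k - 1, which accounts for the repetitions. *)
Lemma zeros_le_crit F T a0 (A := comp (lemn F T) a0) : (1 < size F)%N -> 0 < T ->
  (count_in A (rootseq F) <= (count_in A (rootseq F^`())).+1)%N.
Proof.
move=> F1 T0; have F0 := nonconst_neq0 F1.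
have F'0 := deriv_neq0 F1.
pose l := [seq z <- rootseq F | `[< A z >]].
pose s := undup l.
have sP x : x \in s -> A x /\ F.[x] = 0.
  rewrite mem_undup mem_filter mem_rootseq// => /andP[/asboolP Ax /eqP Fx].
  by [].
have inds : indep (comp (clemn F 0)) s.
  have : uniq s by exact: undup_uniq.
  have : forall x, x \in s -> F.[x] = 0 by move=> x /sP[].
  elim: (s) => [//|x s' IH] s'0 /= /andP[xs' us']; split; last first.
    by apply: IH => // y ys; apply: s'0; rewrite in_cons ys orbT.
  move=> y ys [Y [Yx Y0 cY] Yy].
  have [d d0 dP] := finite_gap (fun z => N (z - x)) (rootseq F) 0.
  have YP z : Y z -> z = x \/ d <= N (z - x).
    move=> /Y0; rewrite /clemn/= => zle.
    have Fz : F.[z] = 0.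
      by apply/eqP; rewrite -normc_eq0 eq_le zle normc_ge0.
    have [->|zx] := eqVneq z x; first by left.
    right; rewrite -[d]add0r; apply: dP; first by rewrite mem_rootseq//; apply/eqP.
    by rewrite normc_gt0 subr_eq0.
  have d2 : d / 2 < d by lra.
  have YU : Y `<=` disc x d.
    apply: (@connected_open_split R Y _ [set z | d / 2 < N (z - x)] x cY _ _ _ _ Yx).
    - exact: open_disc.
    - apply/open_normcP => z /= zc; exists (N (z - x) - d / 2); first by rewrite subr_gt0.
      move=> w; rewrite /disc/= => wz; have := normc_triangle w z x.
      rewrite (normcB z w); lra.
    - move=> z /YP[->|h]; first by left; exact: disc_center.
      by right; rewrite /=; exact: lt_le_trans h.
    - rewrite -subset0 => z [[/YP[->|h] h1]]; rewrite /disc/= in h1 *.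
        by rewrite subrr normc0 => h2; lra.
      by move: (lt_le_trans h1 h); rewrite ltxx.
    - exact: disc_center.
  have [yx|h] := YP y Yy; first by move: xs'; rewrite -yx ys.
  by have := YU y Yy; rewrite /disc/= ltNge h.
have [|d d0 dP] := indep_right F1 _ inds.
  by move=> x /sP[_ Fx]; rewrite /clemn/= Fx normc0.
have [d1 d10 d1P] := finite_gap (fun c => N F.[c]) (rootseq F^`()) 0.
pose r := Num.min T (Num.min (d / 2) d1).
have r0 : 0 < r by rewrite !lt_min T0 d10 divr_gt0.
have [rT rd rd1] : [/\ r <= T, r <= d / 2 & r <= d1].
  by split; rewrite !ge_min lexx ?orbT.
clearbody r.
have szs : (size s <= (crit_above F A r).+1)%N.
  apply: merge => //.
  - by rewrite r0.
  - by apply: dP; lra.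
  - by move=> x /sP[Ax Fx]; split=> //; rewrite /lemn/= Fx normc0.
have -> : count_in A (rootseq F) = (size s + count (mem s) (rootseq F^`()))%N.
  rewrite /count_in -size_filter -/l -(sum_count_undup l) -/s -sum_count_uniq ?undup_uniq//.
  rewrite -sum1_size -big_split /= big_seq [RHS]big_seq; apply: eq_bigr => x xs.
  have [Ax Fx] := sP x xs.
  rewrite count_rootseq// add1n -mup_deriv//; last exact/eqP.
  rewrite -count_rootseq// count_filter; apply: eq_count => z /=.
  by case: eqP => [->|//]; rewrite asboolT.
apply: (leq_trans (leq_add szs (leqnn _))); rewrite addSn ltnS.
rewrite /crit_above -count_predUI.
rewrite [X in (_ + X)%N](_ : _ = 0%N); last first.
  apply/eqP; rewrite -leqn0 leqNgt -has_count; apply/hasPn => c _ /=.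
  apply/negP => /andP[/andP[_ rc] /sP[_ Fc]].
  by move: rc; rewrite Fc normc0 leNgt r0.
rewrite addn0; apply: sub_count => c /= /orP[/andP[]//|/sP[Ac _]].
exact/asboolP.
Qed.

Lemma reps (E : C -> C -> Prop) (l : seq C) :
  (forall x y, E x y -> E y x) -> (forall x, x \in l -> E x x) ->
  exists s, [/\ {subset s <= l}, indep E s &
    forall x, x \in l -> exists2 y, y \in s & E y x].
Proof.
move=> Esym; elim: l => [_|x l IH Er]; first by exists [::].
have [|s [sl ind sP]] := IH; first by move=> y yl; apply: Er; rewrite in_cons yl orbT.
have [[y ys yx]|h] := pselect (exists2 y, y \in s & E y x).
  exists s; split=> //; first by move=> z /sl zl; rewrite in_cons zl orbT.
  by move=> z; rewrite in_cons => /orP[/eqP->|/sP//]; exists y.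
exists (x :: s); split.
- by move=> z; rewrite !in_cons => /orP[->//|/sl->]; rewrite orbT.
- by split=> // y ys /Esym yx; apply: h; exists y.
- move=> z; rewrite in_cons => /orP[/eqP->|/sP[y ys yz]].
    by exists x; [exact: mem_head|apply: Er; exact: mem_head].
  by exists y => //; rewrite in_cons ys orbT.
Qed.

Lemma sum_count_indep B (s l : seq C) : indep (comp B) s ->
  (\sum_(x <- s) count_in (comp B x) l)%N =
  count_in [set z | exists2 x, x \in s & comp B x z] l.
Proof.
elim: s => [_|x s IH /= [xs inds]].
  rewrite big_nil; apply/esym/eqP; rewrite -leqn0 leqNgt -has_count.
  by apply/hasPn => y _ /=; apply/asboolPn => -[].
rewrite big_cons IH// /count_in -count_predUI [X in (_ + X)%N](_ : _ = 0%N).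
  rewrite addn0; apply: eq_count => y /=; rewrite -asbool_or; apply: asbool_equiv_eq.
  split=> [[xy|[z zs zy]]|[z]].
  - by exists x => //; rewrite mem_head.
  - by exists z => //; rewrite in_cons zs orbT.
  - rewrite in_cons => /orP[/eqP->|zs] zy; first by left.
    by right; exists z.
apply/eqP; rewrite -leqn0 leqNgt -has_count; apply/hasPn => y _ /=.
apply/negP => /andP[/asboolP xy /asboolP[z zs zy]]; apply: (xs z zs).
exact: connected_component_trans (connected_component_sym zy).
Qed.

(* Summing [zeros_le_crit] over the components, and [merge] up to a level beyond which the set
   {|F| < r} is connected, gives the total deg F - 1, so every inequality is an equality. *)
Lemma crit_lt_zeros F T a0 (A := comp (lemn F T) a0) : (1 < size F)%N -> lemn F T a0 ->
  (count_in A (rootseq F^`()) < count_in A (rootseq F))%N.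
Proof.
move=> F1 a0T; have F0 := nonconst_neq0 F1.
have T0 : 0 < T := le_lt_trans (normc_ge0 _) a0T.
have zT z : z \in rootseq F -> lemn F T z.
  by rewrite mem_rootseq// => /eqP Fz; rewrite /lemn/= Fz normc0.
have [||s [sF inds sP]] := @reps (comp (lemn F T)) (rootseq F).
- by move=> x y; exact: connected_component_sym.
- by move=> x /zT; exact: connected_component_refl.
pose rho := 1 + \sum_(x <- rootseq F) N x.
have rho0 : 0 < rho by rewrite ltr_pwDl// sumr_ge0// => x _; exact: normc_ge0.
have zrho z : z \in rootseq F -> N z < rho.
  move=> zF; rewrite /rho (big_rem z)//= addrCA.
  have : 0 <= \sum_(y <- rem z (rootseq F)) N y by rewrite sumr_ge0// => x _; exact: normc_ge0.
  lra.
(* At this level all zeros lie in one component, since the disc of radius [rho] contains them and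
   lies in {|F| < Tb}. *)
pose Tb := Num.max T (N (lead_coef F) * (2 * rho) ^+ size (rootseq F) + 1).
have discb : disc 0 rho `<=` lemn F Tb.
  move=> z; rewrite /disc/= subr0 => zr; rewrite /lemn/= lt_max normc_horner.
  apply/orP; right; apply: (@le_lt_trans _ _ (N (lead_coef F) * (2 * rho) ^+ size (rootseq F))).
    rewrite ler_wpM2l ?normc_ge0//; apply: ler_prod_pow => x /zrho xr.
    rewrite normc_ge0 /=; have := normcD z (- x); rewrite normcN; lra.
  by rewrite ltrDl.
have szs : (size s <= (count (fun c => (T <= N F.[c])%R) (rootseq F^`())).+1)%N.
  apply: (@leq_trans (crit_above F (comp (lemn F Tb) 0) T).+1).
    apply: merge => //; first by rewrite T0 /Tb le_max lexx.
    move=> x /sF xF; split; last exact: zT.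
    apply: (@connected_component_max _ _ (disc 0 rho)) => //.
    - exact: disc_center.
    - exact: connected_disc.
    - by rewrite /disc/= subr0 zrho.
  by rewrite ltnS; apply: sub_count => c /= /andP[].
have zsum : (\sum_(x <- s) count_in (comp (lemn F T) x) (rootseq F))%N = (size F).-1.
  rewrite sum_count_indep// -size_rootseq//; apply/eqP; rewrite -all_count.
  by apply/allP => z /sP h; exact/asboolP.
have csum : (count (fun c => (T <= N F.[c])%R) (rootseq F^`()) +
    \sum_(x <- s) count_in (comp (lemn F T) x) (rootseq F^`()))%N = (size F).-2.
  rewrite sum_count_indep// -size_derivC -size_rootseq ?deriv_neq0//.
  rewrite -(count_predC (fun c => T <= N F.[c])); congr addn; apply: eq_count => c /=.
  rewrite -ltNge; apply/asboolP/idP => [[x _ /connected_component_sub]//|cT].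
  have [z zF cz] := zero_in_component F1 cT.
  have [x xs xz] := sP z zF; exists x => //.
  by apply: (connected_component_trans xz); exact: connected_component_sym.
have [q qs qA] : exists2 q, q \in s & comp (lemn F T) q = A.
  have [z zF az] := zero_in_component F1 a0T.
  have [x xs xz] := sP z zF; exists x => //.
  apply: same_connected_component; apply: (connected_component_trans xz).
  exact: connected_component_sym.
rewrite ltnNge; apply/negP; rewrite -qA => zq.
have us : uniq s.
  by apply: indep_uniq inds => x /sF/zT; exact: connected_component_refl.
(* The inequality supposed at [q] makes the sum strict; with [szs], [zsum] and [csum] it says deg F
   < deg F. *)
have : (\sum_(x <- s) count_in (comp (lemn F T) x) (rootseq F) <
   \sum_(x <- s) (count_in (comp (lemn F T) x) (rootseq F^`())).+1)%N.
  rewrite (bigD1_seq q)//= [ltnRHS](bigD1_seq q)//= -addSn leq_add//.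
  by apply: leq_sum => x _; exact: zeros_le_crit.
rewrite zsum; under [ltnRHS]eq_bigr do rewrite -addn1.
rewrite big_split /= sum1_size; apply/negP; rewrite -leqNgt.
have F2 : (size F).-1 = (size F).-2.+1 by case: (size F) F1 => [|[]].
rewrite F2 -csum addnC -addSn; exact: leq_add.
Qed.

End RiemannHurwitz.

(** * Univalent components, Schwarz lemma and Harnack inequality *)

Section Univalence.
Variable R : realType.
Local Notation C := R[i].
Local Notation N := (@ComplexField.Normc.normc R).
Local Notation comp := (@connected_component C).
Implicit Types (p F g h : {poly C}) (x y z w c q a b : C) (A B U V Y : set C) (e r t : R).

Lemma finite_radius (P : C -> R -> Prop) (s : seq C) :
  (forall x e e', P x e -> e' <= e -> P x e') ->
  (forall x, x \in s -> exists2 e, 0 < e & P x e) ->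
  exists2 e, 0 < e & forall x, x \in s -> P x e.
Proof.
move=> Pd; elim: s => [_|x s IH sP]; first by exists 1.
have [|e e0 eP] := IH; first by move=> y ys; apply: sP; rewrite in_cons ys orbT.
have [e' e'0 e'P] := sP x (mem_head _ _).
exists (Num.min e e'); first by rewrite lt_min e0.
move=> y; rewrite in_cons => /orP[/eqP->|/eP yP].
  by apply: Pd e'P _; rewrite ge_min lexx orbT.
by apply: Pd yP _; rewrite ge_min lexx.
Qed.

Lemma rootseq_mul (p q : {poly C}) : p * q != 0 ->
  perm_eq (rootseq (p * q)) (rootseq p ++ rootseq q).
Proof.
move=> pq0; have := pq0; rewrite mulf_eq0 negb_or => /andP[p0 q0].
apply/allP => x _ /=.
by rewrite count_cat !count_rootseq// mupM.
Qed.

(** Up to the leading coefficient of [F], the composite is the product of the [g - x] over the roots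
    x of [F]. *)
Lemma rootseq_comp F g : F != 0 -> (1 < size g)%N ->
  perm_eq (rootseq (F \Po g)) (flatten [seq rootseq (g - x%:P) | x <- rootseq F]).
Proof.
move=> F0 g1; apply/allP => z _ /=.
have gx0 x : g - x%:P != 0 by apply: nonconst_neq0; rewrite size_subC.
have FgE : F \Po g = lead_coef F *: \prod_(x <- rootseq F) (g - x%:P).
  rewrite {1}(poly_rootseq F) linearZ /= rmorph_prod /=; congr (_ *: _).
  by apply: eq_bigr => x _; rewrite rmorphB /= comp_polyX comp_polyC.
have pr0 (s : seq C) : \prod_(x <- s) (g - x%:P) != 0.
  by elim: s => [|x s IH]; rewrite ?big_nil ?oner_eq0// big_cons mulf_neq0.
have lF : lead_coef F != 0 by rewrite lead_coef_eq0.
rewrite count_rootseq; last by rewrite FgE scaler_eq0 negb_or lF pr0.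
rewrite FgE -mul_polyC mupMr ?rootC//.
rewrite count_flatten -map_comp; apply/eqP.
elim: (rootseq F) => [|x s IH]; first by rewrite big_nil mupNroot// root1.
by rewrite big_cons mupM// IH /= count_rootseq.
Qed.

Lemma size_comp_gt1 F g : (1 < size F)%N -> (1 < size g)%N -> (1 < size (F \Po g))%N.
Proof.
move=> F1 g1; have := size_comp_poly F g.
case: (size F) F1 => [|[|a]]// _; case: (size g) g1 => [|[|b]]// _ /=.
by case: (size _) => [|[|n]].
Qed.

Lemma open_component_sep A x a0 : open A -> A x -> ~ comp A a0 x ->
  exists2 e, 0 < e & disc x e `&` comp A a0 = set0.
Proof.
move=> /open_normcP oA Ax nx; have [e e0 eA] := oA x Ax.
exists e => //; rewrite -subset0 => z [xz Az]; apply: nx.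
apply: (@component_absorb R A a0 (disc x e) z) => //.
  exact: connected_disc.
exact: disc_center.
Qed.

Lemma lemn_comp_image F g T a0 z : comp (lemn (F \Po g) T) a0 z ->
  comp (lemn F T) g.[a0] g.[z].
Proof.
move=> [Y [Ya YT cY] Yz]; exists [set g.[w] | w in Y]; last by exists z.
split; first by exists a0.
  by move=> _ [w /YT + <-]; rewrite /lemn/= horner_comp.
exact: connected_image.
Qed.

Lemma lemn_comp_surj F g T a0 y : (1 < size g)%N -> lemn (F \Po g) T a0 ->
  comp (lemn F T) g.[a0] y -> exists2 w, comp (lemn (F \Po g) T) a0 w & g.[w] = y.
Proof.
move=> g1 a0T Qy; set Q := comp (lemn F T) g.[a0].
have [|w aw gw] := @component_surj _ g Q a0 y g1 (@open_component R _ _ (@open_lemn R F T))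
  (@component_connected _ (lemn F T) g.[a0]) _ Qy.
  by apply: connected_component_refl; move: a0T; rewrite /lemn/= horner_comp.
exists w => //; apply: comp_mono aw => z /connected_component_sub.
by rewrite /lemn/= horner_comp.
Qed.

Lemma simple_roots_in g A y : (1 < size g)%N -> (forall z, A z -> ~~ root g^`() z) ->
  uniq [seq z <- rootseq (g - y%:P) | `[< A z >]].
Proof.
move=> g1 nc; have P0 : g - y%:P != 0 by apply: nonconst_neq0; rewrite size_subC.
apply: count_mem_uniq => x; rewrite count_filter mem_filter mem_rootseq//.
have [Ax|nAx] := pselect (A x); last first.
  rewrite asboolF//=; apply/eqP; rewrite -leqn0 leqNgt -has_count.
  by apply/hasPn => z _ /=; apply/negP => /andP[/eqP-> /asboolP].
rewrite asboolT//= (eq_count (a2 := pred1 x)); last first.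
  by move=> z /=; case: eqP => [->|//]; rewrite asboolT.
rewrite count_rootseq//; case: (boolP (root _ x)) => [rx|]; last exact: mupNroot.
by rewrite mup_deriv// derivB derivC subr0 mupNroot// nc.
Qed.

(** * Degree of a polynomial on a component without critical points *)

Section Covering.
Variables (F g : {poly C}) (T : R) (a0 : C).
Hypotheses (F1 : (1 < size F)%N) (g1 : (1 < size g)%N).
Let A := comp (lemn (F \Po g) T) a0.
Let Q := comp (lemn F T) g.[a0].
Hypotheses (a0T : lemn (F \Po g) T a0) (ncrit : forall z, A z -> ~~ root g^`() z).

Let sheet y := [seq z <- rootseq (g - y%:P) | `[< A z >]].

Let mem_sheet y z : (z \in sheet y) = `[< A z >] && (g.[z] == y).
Proof.
by rewrite mem_filter mem_rootseq ?root_subC//; apply: nonconst_neq0; rewrite size_subC.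
Qed.

(** One radius serves the whole fibre over [y0]: about points of [A] the disc lies in [A] and [g] is
    injective on it, about the others it misses [A]. By [near_preimage] the fibres in [A] over [y]
    and [y0] then inject into each other. *)
Lemma sheets_locally_constant y0 : Q y0 ->
  exists2 d, 0 < d & forall y, disc y0 d y -> size (sheet y) = size (sheet y0).
Proof.
move=> Qy0; have P0 : g - y0%:P != 0 by apply: nonconst_neq0; rewrite size_subC.
pose P x e := [/\ A x -> disc x e `<=` A,
  A x -> forall z w, disc x e z -> disc x e w -> g.[z] = g.[w] -> z = w,
  ~ A x -> disc x e `&` A = set0 &
  forall x', x' \in rootseq (g - y0%:P) -> x' != x -> 2 * e <= N (x' - x)].
have oA : open A by apply: open_component; exact: open_lemn.
have [||e e0 eP] := @finite_radius P (rootseq (g - y0%:P)).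
- move=> x e e' [P1 P2 P3 P4] e'e.
  have ee z : disc x e' z -> disc x e z by rewrite /disc/= => /lt_le_trans; apply.
  split.
  + by move=> Ax z /ee/(P1 Ax).
  + by move=> Ax z w /ee xz /ee xw; exact: P2.
  + by move=> /P3 h; rewrite -subset0 => z [/ee xz Az]; rewrite -h.
  + move=> x' x'g x'x; apply: le_trans (P4 x' x'g x'x).
    by rewrite ler_pM2l.
- move=> x xg; have [d d0 dP] := finite_gap (fun z => N (z - x)) (rootseq (g - y0%:P)) 0.
  have d4 (e : R) : e <= d / 2 -> forall x', x' \in rootseq (g - y0%:P) -> x' != x ->
      2 * e <= N (x' - x).
    move=> ed x' x'g x'x; apply: (@le_trans _ _ (0 + d)); first by lra.
    by apply: dP => //; rewrite normc_gt0 subr_eq0.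
  have [Ax|nAx] := pselect (A x).
    have [e1 e10 e1P] := (open_normcP A).1 oA x Ax.
    have [e2 e20 e2P] := few_near_roots x g1.
    rewrite mupNroot in e2P; last exact: ncrit.
    exists (Num.min (d / 2) (Num.min e1 e2)); first by rewrite !lt_min e10 divr_gt0.
    split => //.
    + by move=> _ z; rewrite /disc/= !lt_min => /and3P[_ + _] => /e1P.
    + move=> _ z w; rewrite /disc/= !lt_min => /and3P[_ _ zx] /and3P[_ _ wx] gzw.
      apply/eqP; apply: contrapT => /negP zw.
      have : (size [:: z; w] <= 1)%N.
        apply: (e2P g.[w]) => /=; first by rewrite inE zw.
        by move=> u; rewrite !inE => /orP[/eqP->|/eqP->].
      by [].
    + by apply: d4; rewrite ge_min lexx.
  have xT : lemn (F \Po g) T x.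
    move: xg; rewrite mem_rootseq// root_subC => /eqP gx.
    by rewrite /lemn/= horner_comp gx; exact: connected_component_sub Qy0.
  have [e e0 eE] := open_component_sep (@open_lemn R _ _) xT nAx.
  exists (Num.min (d / 2) e); first by rewrite lt_min e0 divr_gt0.
  split => //; last by apply: d4; rewrite ge_min lexx.
  move=> _; rewrite -subset0 => z []; rewrite /disc/= lt_min => /andP[_ xz] Az.
  by have : (disc x e `&` A) z by []; rewrite eE.
exists (N (lead_coef g) * e ^+ (size g).-1); first exact: lead_pow_gt0.
move=> y; rewrite /disc/= => y0y; apply/eqP; rewrite eqn_leq; apply/andP; split.
  have /choice[f fP] : forall z, exists x, z \in sheet y ->
      [/\ x \in sheet y0, disc x e z & x \in rootseq (g - y0%:P)].
    move=> z; have [|_] := boolP (z \in sheet y); last by exists z.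
    rewrite mem_sheet => /andP[/asboolP Az /eqP gz].
    have [||x gx zx] := @near_preimage _ g y0 z e g1 => //; first by rewrite gz.
    have xr : x \in rootseq (g - y0%:P) by rewrite mem_rootseq// root_subC gx.
    exists x => _; split=> //.
    rewrite mem_sheet gx eqxx andbT; apply/asboolP; apply: contrapT => nAx.
    have [_ _ h _] := eP x xr; have : (disc x e `&` A) z by [].
    by rewrite h.
  rewrite -(size_map f); apply: uniq_leq_size.
    rewrite map_inj_in_uniq; first exact: simple_roots_in.
    move=> z w zy wy fzw; have [fz1 fz2 fz3] := fP z zy; have [_ fw2 _] := fP w wy.
    have [_ inj _ _] := eP _ fz3; apply: inj => //.
    - by move: fz1; rewrite mem_sheet => /andP[/asboolP].
    - by rewrite fzw.
    - by move: zy wy; rewrite !mem_sheet => /andP[_ /eqP->] /andP[_ /eqP->].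
  by move=> _ /mapP[z zy ->]; case: (fP z zy).
have sheetr x : x \in sheet y0 -> x \in rootseq (g - y0%:P).
  by rewrite mem_filter => /andP[].
have /choice[f fP] : forall x, exists z, x \in sheet y0 -> z \in sheet y /\ disc x e z.
  move=> x; have [|_] := boolP (x \in sheet y0); last by exists x.
  move=> /[dup] /sheetr xr; rewrite mem_sheet => /andP[/asboolP Ax /eqP gx].
  have [||z gz xz] := @near_preimage _ g y x e g1 => //; first by rewrite gx normcB.
  have zx : disc x e z by rewrite /disc/= normcB.
  exists z => _; split=> //; rewrite mem_sheet gz eqxx andbT; apply/asboolP.
  by have [h _ _ _] := eP x xr; exact: h Ax z zx.
rewrite -(size_map f); apply: uniq_leq_size.
  rewrite map_inj_in_uniq; first exact: simple_roots_in.
  move=> z w zy wy fzw; have [_ fz] := fP z zy; have [_ fw] := fP w wy.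
  apply/eqP; apply: contrapT => /negP zw.
  have [_ _ _ /(_ z (sheetr z zy) zw)] := eP w (sheetr w wy).
  have := normc_triangle (f z) z w; move: fz fw; rewrite /disc/= fzw (normcB z (f w)).
  lra.
by move=> _ /mapP[z zy ->]; case: (fP z zy).
Qed.

Lemma sheets_constant y : Q y -> size (sheet y) = size (sheet g.[a0]).
Proof.
pose U (b : bool) := [set y | Q y /\ (size (sheet y) == size (sheet g.[a0])) = b].
have oQ : open Q by apply: open_component; exact: open_lemn.
have oU (b : bool) : open (U b).
  apply/open_normcP => u [Qu ub].
  have [d d0 dP] := sheets_locally_constant Qu.
  have [d' d'0 d'P] := (open_normcP Q).1 oQ u Qu.
  exists (Num.min d d'); first by rewrite lt_min d0.
  move=> v; rewrite /disc/= lt_min => /andP[vd vd']; split; first exact: d'P.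
  by rewrite dP.
have Qa0 : Q g.[a0].
  by apply: connected_component_refl; move: a0T; rewrite /lemn/= horner_comp.
move=> Qy; apply/eqP; suff : Q `<=` U true by move=> /(_ y Qy)[].
apply: (@connected_open_split R Q (U true) (U false) g.[a0]) => //.
- exact: component_connected.
- move=> u Qu; case E : (size (sheet u) == size (sheet g.[a0])); [left|right] => //.
- by rewrite -subset0 => u [[_ [_ h]] [_]]; rewrite h.
- by split=> //; rewrite eqxx.
Qed.

(** A root of [p] in [Q] has as many preimages in [A] as there are sheets, a root outside [Q] has
    none. *)
Lemma count_comp p : p != 0 ->
  count_in A (rootseq (p \Po g)) = (size (sheet g.[a0]) * count_in Q (rootseq p))%N.
Proof.
move=> p0; rewrite /count_in (permP (rootseq_comp p0 g1)) count_flatten -map_comp.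
elim: (rootseq p) => [|x s IH] /=; first by rewrite muln0.
rewrite IH mulnDr; congr addn; rewrite -size_filter -/(sheet x).
have [Qx|nQx] := pselect (Q x); first by rewrite asboolT// muln1 sheets_constant.
rewrite asboolF// muln0; apply/eqP; rewrite -leqn0 leqNgt; apply/negP => s0.
have [z] : exists z, z \in sheet x.
  by case: (sheet x) s0 => // z l _; exists z; rewrite mem_head.
rewrite mem_sheet => /andP[/asboolP Az /eqP gz]; apply: nQx; rewrite -gz.
exact: lemn_comp_image Az.
Qed.

(* If [g] has degree [m] from [A] to [Q], then [A] contains [m] times as many zeros and critical
   points of [F \Po g] as [Q] does of [F], so the two counts differ by [m]. *)
Lemma noncritical_injective x y : A x -> A y -> g.[x] = g.[y] -> x = y.
Proof.
move=> Ax Ay gxy; apply/eqP; apply: contrapT => /negP xy.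
have T0 : 0 < T := le_lt_trans (normc_ge0 _) a0T.
have F'0 := deriv_neq0 F1.
have Fg1 := size_comp_gt1 F1 g1.
have F'g0 : (F \Po g)^`() != 0 by exact: deriv_neq0.
have := @zeros_le_crit R _ T a0 Fg1 T0; rewrite -/A.
rewrite count_comp ?nonconst_neq0//.
have -> : count_in A (rootseq (F \Po g)^`()) = (size (sheet g.[a0]) * count_in Q (rootseq F^`()))%N.
  rewrite deriv_comp in F'g0 *.
  rewrite /count_in (permP (rootseq_mul F'g0)) count_cat -!/(count_in _ _) count_comp//.
  rewrite [X in (_ + X)%N](_ : _ = 0%N) ?addn0//.
  apply/eqP; rewrite -leqn0 leqNgt -has_count; apply/hasPn => z.
  rewrite mem_rootseq; last exact: deriv_neq0.
  by move=> zr /=; apply/asboolPn => /ncrit; rewrite zr.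
have Fa0 : lemn F T g.[a0] by move: a0T; rewrite /lemn/= horner_comp.
have := crit_lt_zeros F1 Fa0; rewrite -/Q.
have : (1 < size (sheet g.[a0]))%N.
  rewrite -(@sheets_constant g.[x]); last exact: lemn_comp_image.
  have -> : 2%N = size [:: x; y] by [].
  apply: uniq_leq_size => /=; first by rewrite inE xy.
  by move=> z; rewrite !inE mem_sheet => /orP[/eqP->|/eqP->]; rewrite ?gxy eqxx asboolT.
move: (size _) (count_in _ _) (count_in _ _) => m d k m1 kd.
rewrite leqNgt => /negP; apply.
apply: (@leq_trans (m * k.+1)); last by rewrite leq_mul2l kd orbT.
by rewrite mulnS -addn2 addnC leq_add2r.
Qed.

End Covering.

(** * Minimum principle, Schwarz lemma and Harnack inequality *)

Lemma component_boundary p T a0 z :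
  closure (comp (lemn p T) a0) z -> ~ comp (lemn p T) a0 z -> T <= N p.[z].
Proof.
move=> zc nz; rewrite leNgt; apply/negP => zT.
have [e e0 eE] := open_component_sep (@open_lemn R p T) zT nz.
have [w aw wz] := (closure_normcP _ _).1 zc e e0.
by have : (disc z e `&` comp (lemn p T) a0) w by []; rewrite eE.
Qed.

(* The component of {|p| < mu} through a bad point cannot cross the boundary of [A], but it
   contains a zero of [p]. *)
Lemma minimum_principle p A mu rho : open A -> (forall z, A z -> N z <= rho) ->
  (forall z, A z -> ~~ root p z) ->
  (forall z, closure A z -> ~ A z -> mu <= N p.[z]) ->
  forall z, A z -> mu <= N p.[z].
Proof.
move=> oA bA nz bd z Az; rewrite leNgt; apply/negP => zmu.
pose Y := comp (lemn p mu) z.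
have Yz : Y z by exact: connected_component_refl.
have YA : Y `<=` A.
  apply: (@connected_open_split R Y A (~` closure A) z) => //.
  - exact: component_connected.
  - by apply: closed_openC; exact: closed_closure.
  - move=> w /connected_component_sub wmu.
    have [Aw|nAw] := pselect (A w); [by left|right => cw].
    by have := bd w cw nAw; rewrite leNgt wmu.
  - by rewrite -subset0 => w [[_ /subset_closure]].
(* For constant [p] the set {|p| < mu} would be the whole plane, whereas [A] is bounded. *)
have [p1|p1] := leqP (size p) 1.
  have pc w : p.[w] = p.[z] by rewrite (size1_polyC p1) !hornerC.
  have : lemn p mu `<=` Y.
    apply: connected_component_max => //.
    by apply: connected_convex => x y t _ _ _; rewrite /lemn/= pc.
  have mz : lemn p mu (`|rho| + 1)%:C by rewrite /lemn/= pc.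
  move=> /(_ _ mz)/YA/bA; rewrite normc_real ger0_norm; last by rewrite addr_ge0.
  have := ler_norm rho; lra.
have [w wp zw] := zero_in_component p1 zmu.
have p0 := nonconst_neq0 p1.
by rewrite mem_rootseq// in wp; have := nz w (YA w zw); rewrite wp.
Qed.

(** The quotient of [h - q] by z - a has no zero in [A], since [a] is the only zero of [h - q] there
    and is simple. On the boundary its modulus is at least r / rho, hence also inside. *)
Lemma schwarz h q r rho a (A := comp (lemn (h - q%:P) r) a) : (1 < size h)%N ->
  h.[a] = q -> 0 < r -> 0 < rho -> (count_in A (rootseq (h - q%:P)) <= 1)%N ->
  (forall z, A z -> N (z - a) <= rho) ->
  forall z, A z -> r * N (z - a) <= rho * N (h.[z] - q).
Proof.
move=> h1 ha r0 rho0 one bA z Az.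
have P0 : h - q%:P != 0 by apply: nonconst_neq0; rewrite size_subC.
have PE w : (h - q%:P).[w] = h.[w] - q by rewrite !hornerE.
have [psi psiE] : exists psi : {poly C}, h - q%:P = psi * ('X - a%:P).
  by apply/factor_theorem; rewrite root_subC ha.
have Aa : A a by apply: connected_component_refl; rewrite /lemn/= PE ha subrr normc0.
have nP w : N (h.[w] - q) = N psi.[w] * N (w - a).
  by rewrite -PE psiE hornerM hornerXsubC normcM.
have psi0 : psi != 0 by apply: contraNneq P0 => p0; rewrite psiE p0 mul0r.
have X0 : 'X - a%:P != 0 by rewrite polyXsubC_eq0.
have nz w : A w -> ~~ root psi w.
  move=> Aw; apply/negP => pw; move: one; rewrite leqNgt => /negP; apply.
  have PX0 : psi * ('X - a%:P) != 0 by rewrite -psiE.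
  rewrite psiE /count_in (permP (rootseq_mul PX0)) count_cat.
  apply: (@leq_add 1 1); rewrite -has_count; apply/hasP.
    by exists w; [rewrite mem_rootseq|apply/asboolP].
  by exists a; [rewrite mem_rootseq// root_XsubC|apply/asboolP].
have : r / rho <= N psi.[z].
  apply: (@minimum_principle psi A (r / rho) (rho + N a)) => //.
  - by apply: open_component; exact: open_lemn.
  - by move=> w /bA; have := normc_triangle a w 0; rewrite !subr0; lra.
  move=> w cw nw; have := component_boundary cw nw; rewrite PE nP => rw.
  have wa : N (w - a) <= rho.
    rewrite leNgt; apply/negP => wa.
    have d0 : 0 < N (w - a) - rho by rewrite subr_gt0.
    have [v /bA Av vw] := (closure_normcP _ _).1 cw _ d0.
    have := normc_triangle v w a; rewrite (normcB w v); lra.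
  rewrite ler_pdivrMr//; apply: (le_trans rw).
  by rewrite ler_wpM2l ?normc_ge0.
rewrite ler_pdivrMr// nP => h2.
by rewrite mulrA (mulrC rho) ler_wpM2r ?normc_ge0.
Qed.

(* Since [z - b] does not vanish on [A], its [k.+1]-th root lifts to a component lying in the
   unit disc, centered at distance at most 1/2 from 0, where the Schwarz lemma applies. *)
Lemma harnack h q r b a R1 k (A := comp (lemn (h - q%:P) r) a) : (1 < size h)%N ->
  h.[a] = q -> 0 < r -> 0 < R1 -> (forall z, A z -> ~~ root h^`() z) ->
  ~ A b -> (forall z, A z -> N (z - b) <= R1) -> N (a - b) <= R1 * (1 / 2) ^+ k.+1 ->
  forall z, A z -> N (h.[z] - q) <= r / 8 -> N (z - b) <= R1 * (3 / 4) ^+ k.+1.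
Proof.
move=> h1 ha r0 R10 ncrit nAb bA ab z Az zq.
have P1 : (1 < size (h - q%:P)%R)%N by rewrite size_subC.
have PE w : (h - q%:P).[w] = h.[w] - q by rewrite !hornerE.
have Aa : A a by apply: connected_component_refl; rewrite /lemn/= PE ha subrr normc0.
have R1C0 : R1%:C != 0 by rewrite -normc_gt0 normc_real gtr0_norm.
(* The map [phi] is critical at most over [b], which [A] omits, so the lift [Y] of [A] contains no
   critical point of [h \Po phi]. *)
pose phi : {poly C} := R1%:C *: 'X^(k.+1) + b%:P.
have phiE y : phi.[y] = R1%:C * y ^+ k.+1 + b by rewrite hornerD hornerZ hornerXn hornerC.
have phi1 : (1 < size phi)%N.
  rewrite size_polyDl ?size_scale// ?size_polyXn// size_polyC.
  by case: (b != 0).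
have nphi y : N (phi.[y] - b) = R1 * N y ^+ k.+1.
  by rewrite phiE addrK normcM normcX normc_real gtr0_norm.
have [y0 phiy0] := surj_poly a phi1.
have y0a : (h \Po phi).[y0] = q by rewrite horner_comp phiy0.
have H1 := size_comp_gt1 h1 phi1.
have HE : (h - q%:P) \Po phi = (h \Po phi) - q%:P by rewrite rmorphB /= comp_polyC.
pose Y := comp (lemn ((h \Po phi) - q%:P) r) y0.
have YA y : Y y -> A phi.[y].
  by rewrite /Y -HE => /lemn_comp_image; rewrite phiy0.
have y0r : lemn ((h - q%:P) \Po phi) r y0.
  by rewrite /lemn/= horner_comp phiy0 PE ha subrr normc0.
have [y Yy phiy] : exists2 y, Y y & phi.[y] = z.
  have [|y] := @lemn_comp_surj (h - q%:P) phi r y0 z phi1 y0r.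
    by rewrite phiy0.
  by rewrite HE; exists y.
have Y1 w : Y w -> N w <= 1.
  move=> /YA/bA; rewrite nphi -[leRHS]mulr1 ler_pM2l// => hw.
  by rewrite -(@ler_pXn2r _ k.+1)// ?nnegrE ?normc_ge0// expr1n.
have P01 : (h \Po phi) - q%:P != 0 by apply: nonconst_neq0; rewrite size_subC.
have oneY : (count_in Y (rootseq ((h \Po phi) - q%:P)) <= 1)%N.
  have HP1 : (1 < size ((h \Po phi) - q%:P)%R)%N by rewrite size_subC.
  apply: leq_trans (@zeros_le_crit R _ r y0 HP1 r0) _; rewrite ltnS leqn0.
  rewrite -/Y -leqn0 leqNgt -has_count; apply/hasPn => w.
  rewrite mem_rootseq ?deriv_neq0// derivB derivC subr0 deriv_comp rootM => wr /=.
  apply/asboolPn => /[dup] Yw /YA /[dup] Aw /ncrit nr.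
  have rE : root (h^`() \Po phi) w = root h^`() phi.[w] by rewrite /root horner_comp.
  move: wr; rewrite rE (negPf nr) /root /=.
  rewrite derivD derivC addr0 derivZ derivXn hornerZ hornerMn hornerXn.
  rewrite mulf_eq0 (negPf R1C0) mulrn_eq0 expf_eq0 /= => /andP[_ /eqP w0].
  by apply: nAb; move: Aw; rewrite phiE w0 expr0n/= mulr0 add0r.
have y0h : N y0 <= 1 / 2.
  have : N (phi.[y0] - b) <= R1 * (1 / 2) ^+ k.+1 by rewrite phiy0.
  by rewrite nphi ler_pM2l// ler_pXn2r// ?nnegrE ?normc_ge0// divr_ge0.
(* [Y] lies in the unit disc, so 2 bounds its diameter; with |h(z) - q| <= r / 8 this gives |y - y0|
   <= 1/4, hence |y| <= 3/4. *)
have := @schwarz (h \Po phi) q r 2 y0 H1 y0a r0 (ltr0Sn _ 1) oneY _ y Yy.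
move=> /(_ _)hs; have {}hs : r * N (y - y0) <= 2 * N ((h \Po phi).[y] - q).
  apply: hs => w /Y1 w1; have := normcD w (- y0); rewrite normcN; lra.
rewrite horner_comp phiy in hs.
have yy0 : N (y - y0) <= 1 / 4.
  have : r * N (y - y0) <= r * (1 / 4) by apply: (le_trans hs); lra.
  by rewrite ler_pM2l.
rewrite -phiy nphi ler_pM2l// ler_pXn2r// ?nnegrE ?normc_ge0 ?divr_ge0//.
by have := normcD (y - y0) y0; rewrite subrK; lra.
Qed.

End Univalence.

(** * Escape levels and puzzle pieces *)

Section Pieces.
Variable R : realType.
Local Notation C := R[i].
Local Notation N := (@ComplexField.Normc.normc R).
Local Notation comp := (@connected_component C).
Implicit Types (f : {poly C}) (x y z w c q a b : C) (e r t : R).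

Fixpoint fpow (f : {poly C}) n : {poly C} := if n is n'.+1 then f \Po fpow f n' else 'X.

Lemma horner_fpow f n z : (fpow f n).[z] = iterate f n z.
Proof.
elim: n => [|n IH] /=; first by rewrite hornerX.
by rewrite horner_comp IH.
Qed.

Lemma iterateD (f : {poly C}) m n z : iterate f (m + n) z = iterate f m (iterate f n z).
Proof. by rewrite /iterate iterD. Qed.

Lemma fpowD (f : {poly C}) m n : fpow f (m + n) = fpow f m \Po fpow f n.
Proof.
elim: m => [|m IH] /=; first by rewrite comp_polyX.
by rewrite IH comp_polyA.
Qed.

Lemma fpow1 (f : {poly C}) : fpow f 1 = f.
Proof. by rewrite /= comp_polyXr. Qed.

Lemma size_fpow f n : (1 < size f)%N -> (1 < size (fpow f n))%N.
Proof.
by move=> f1; elim: n => [|n IH] /=; [rewrite size_polyX|exact: size_comp_gt1].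
Qed.

Lemma root_deriv_fpow (f : {poly C}) n z : root (fpow f n)^`() z ->
  exists2 i, (i < n)%N & root f^`() (iterate f i z).
Proof.
elim: n => [|n IH] /=; first by rewrite derivX (negPf (root1 _)).
rewrite deriv_comp rootM => /orP[|/IH[i ni ri]].
  by rewrite {1}/root horner_comp horner_fpow => h; exists n.
by exists i => //; exact: ltnW.
Qed.

Lemma normc_horner_bounds f (f1 : f != 0) :
  exists2 rho, 0 < rho & forall z, rho <= N z ->
    N (lead_coef f) * (N z / 2) ^+ (size f).-1 <= N f.[z] /\
    N f.[z] <= N (lead_coef f) * (2 * N z) ^+ (size f).-1.
Proof.
pose rho := 2 * (1 + \sum_(x <- rootseq f) N x).
have rho0 : 0 < rho by rewrite mulr_gt0// ltr_pwDl// sumr_ge0// => x _; exact: normc_ge0.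
exists rho => // z zr.
have fac x : x \in rootseq f -> N z / 2 <= N (z - x) <= 2 * N z.
  move=> xf; have : N x <= rho / 2.
    rewrite /rho (mulrC 2) mulfK ?pnatr_eq0// (big_rem x)//= addrCA lerDl.
    by rewrite addr_ge0// sumr_ge0// => y _; exact: normc_ge0.
  have := normc_triangle x z 0; have := normcD z (- x); rewrite normcN !subr0 => h1 h2 h3.
  by apply/andP; split; lra.
rewrite normc_horner -size_rootseq//; split; rewrite ler_wpM2l ?normc_ge0//; last first.
  by apply: ler_prod_pow => x /fac/andP[_ ->]; rewrite normc_ge0.
elim: (rootseq f) fac => [|x s IH] fac; first by rewrite big_nil expr0.
rewrite big_cons /= exprS ler_pM ?divr_ge0 ?exprn_ge0 ?normc_ge0 ?divr_ge0 ?normc_ge0//.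
  by have /andP[] := fac x (mem_head _ _).
by apply: IH => y ys; apply: fac; rewrite in_cons ys orbT.
Qed.

Definition escape_radius (f : {poly C}) (rho : R) :=
  0 < rho /\ forall z, rho <= N z -> 2 * N z <= N f.[z].

(** Pigeonhole, contrapositively: if decreasing conditions are met at every depth by some member of
    a finite list, one member meets all of them. *)
Lemma finite_exit (Q : nat -> C -> Prop) (s : seq C) :
  (forall k l x, (k <= l)%N -> Q l x -> Q k x) ->
  (forall x, x \in s -> exists k, ~ Q k x) ->
  exists k, forall x, x \in s -> ~ Q k x.
Proof.
move=> Qd; elim: s => [_|x s IH sP]; first by exists 0%N.
have [|k kP] := IH; first by move=> y ys; apply: sP; rewrite in_cons ys orbT.
have [l lP] := sP x (mem_head _ _); exists (maxn k l) => y.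
rewrite in_cons => /orP[/eqP->|/kP h] Qy.
  by apply: lP; apply: Qd Qy; rewrite leq_maxr.
by apply: h; apply: Qd Qy; rewrite leq_maxl.
Qed.

(** * Escape levels, their components and the filled Julia set *)

Section EscapeLevels.
Variables (f : {poly C}) (rho : R).
Hypotheses (f1 : (1 < size f)%N) (esc : escape_radius f rho).
Local Notation K := (filled_julia f).
Local Notation U k := (lemn (fpow f k) rho).
Local Notation P k := (comp (U k)).

Lemma mem_level k z : U k z = (N (iterate f k z) < rho) :> Prop.
Proof. by rewrite /lemn/= horner_fpow. Qed.

Lemma level_add k n z : U (k + n)%N z = U k (iterate f n z) :> Prop.
Proof. by rewrite !mem_level iterateD. Qed.

(** If |f^k(z)| were at least [rho], the next modulus would be at least 2 rho. Thus open and closed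
    levels interleave, and limits can be taken in the closed ones. *)
Lemma clevel_level k : clemn (fpow f k.+1) rho `<=` U k.
Proof.
have [rho0 esc'] := esc.
move=> z; rewrite /clemn/= horner_comp horner_fpow mem_level => h.
rewrite ltNge; apply/negP => /[dup] h2 /esc'; lra.
Qed.

Lemma level_anti k l : (k <= l)%N -> U l `<=` U k.
Proof.
move=> /subnK <-; elim: (l - k)%N => [//|m IH] z; rewrite addSn => Uz.
by apply: IH; apply: clevel_level; exact: lemn_clemn.
Qed.

Lemma piece_anti k l x y : (k <= l)%N -> P l x y -> P k x y.
Proof. by move=> kl; apply: comp_mono; exact: level_anti. Qed.

Lemma juliaP z : K z <-> forall k, U k z.
Proof.
have [rho0 esc'] := esc; split=> [Kz k|Uz]; last first.
  exists rho%:C; split; first by rewrite complex_real eqxx.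
  move=> M rM n _ /=; rewrite norm_normc; apply: le_trans (ltW rM).
  by rewrite lecR; apply: ltW; rewrite -mem_level.
rewrite mem_level ltNge; apply/negP => zk.
have grow j : 2 ^+ j * rho <= N (iterate f (j + k) z).
  elim: j => [|j IH]; first by rewrite expr0 mul1r.
  rewrite addSn {1}/iterate iterS -/(iterate _ _ _) exprS -mulrA.
  apply: le_trans (esc' _ _); first by rewrite ler_pM2l.
  apply: le_trans IH; rewrite ler_peMl ?(ltW rho0)//.
  by rewrite exprn_ege1// ler1n.
have [M [Mreal Mb]] := Kz.
pose m := `|complex.Re M| + 1.
have {}Mb n : N (iterate f n z) <= m.
  have : `|iterate f n z| <= m%:C.
    apply: Mb => //; rewrite -(RRe_real Mreal) ltcR /m.
    by have := ler_norm (complex.Re M); lra.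
  by rewrite norm_normc lecR.
pose j := Num.truncn (m / rho).
have := Mb (j + k)%N; apply/negP; rewrite -ltNge; apply: lt_le_trans (grow j).
rewrite -ltr_pdivrMr//; apply: (lt_le_trans (truncnS_gt _)).
by rewrite -/j -natrX ler_nat ltn_expl.
Qed.

Lemma julia_iterate n z : K z -> K (iterate f n z).
Proof. by move=> /juliaP Uz; apply/juliaP => k; rewrite -level_add. Qed.

Lemma julia_level k z : K z -> U k z.
Proof. by move=> /juliaP. Qed.

Lemma julia_closed z : (forall k, clemn (fpow f k) rho z) -> K z.
Proof. by move=> h; apply/juliaP => k; exact: clevel_level. Qed.

Lemma julia_piece k z w : comp K z w -> P k z w.
Proof. by apply: comp_mono => x; exact: julia_level. Qed.

(** The closed pieces are nested, bounded and connected, so their intersection is connected, and it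
    lies in K. *)
Lemma pieces_julia z w : K z -> (forall k, P k z w) -> comp K z w.
Proof.
move=> Kz zw; pose X n := comp (clemn (fpow f n) rho) z.
have cX : connected (\bigcap_n X n).
  apply: (@connected_bigcap_nested _ X rho).
  - by move=> n; apply: component_closed; exact: closed_clemn.
  - by move=> n; exact: component_connected.
  - move=> n; apply: comp_mono => x /clevel_level; exact: lemn_clemn.
  - by move=> x /connected_component_sub; rewrite /clemn/= hornerX.
exists (\bigcap_n X n).
  split=> //.
    move=> n _; apply: connected_component_refl; apply: lemn_clemn.
    exact: julia_level.
  by move=> x Xx; apply: julia_closed => k; exact: connected_component_sub (Xx k I).
by move=> n _; apply: comp_mono (zw n); exact: lemn_clemn.
Qed.

Lemma piece_image k n z w : P (k + n)%N z w -> P k (iterate f n z) (iterate f n w).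
Proof. by rewrite fpowD => /lemn_comp_image; rewrite !horner_fpow. Qed.

Lemma piece_surj k n z y : U (k + n)%N z -> P k (iterate f n z) y ->
  exists2 w, P (k + n)%N z w & iterate f n w = y.
Proof.
rewrite fpowD => Uz Py.
have [||w zw <-] := @lemn_comp_surj _ (fpow f k) (fpow f n) rho z y _ Uz.
- exact: size_fpow.
- by rewrite horner_fpow.
by exists w => //; rewrite horner_fpow.
Qed.

Lemma julia_image n z w : comp K z w -> comp K (iterate f n z) (iterate f n w).
Proof.
move=> zw; have Kz : K z.
  exact: connected_component_sub (connected_component_sym zw).
apply: pieces_julia; first exact: julia_iterate.
by move=> k; apply: piece_image; exact: julia_piece.
Qed.

(** Every piece of depth k + n around [z] meets the fibre of f^n over [y]; the fibre is finite, so
    one of its points lies in all the pieces. *)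
Lemma julia_surj n z y : K z -> comp K (iterate f n z) y ->
  exists2 w, comp K z w & iterate f n w = y.
Proof.
move=> Kz zy.
have fn1 : (1 < size (fpow f n))%N by exact: size_fpow.
have P0 : fpow f n - y%:P != 0 by apply: nonconst_neq0; rewrite size_subC.
apply: contrapT => h.
have [||k kP] := @finite_exit (fun k x => P (k + n)%N z x) (rootseq (fpow f n - y%:P)).
- by move=> k l x kl; apply: piece_anti; rewrite leq_add2r.
- move=> x; rewrite mem_rootseq// root_subC horner_fpow => /eqP xy.
  apply: contrapT => /forallNP hx; apply: h; exists x => //.
  apply: pieces_julia => // k; apply: (@piece_anti _ (k + n)); first by rewrite leq_addr.
  by apply: contrapT; exact: hx.
have [w zw wy] := piece_surj (julia_level (k + n) Kz) (julia_piece k zy).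
by apply: (kP w) => //; rewrite mem_rootseq// root_subC horner_fpow wy.
Qed.

End EscapeLevels.
End Pieces.

(** * Components avoiding the critical point *)

Section Shrinking.
Variable R : realType.
Local Notation C := R[i].
Local Notation N := (@ComplexField.Normc.normc R).
Local Notation comp := (@connected_component C).
Implicit Types (x y z w c q a b : C) (e r t : R).
Variables (f : {poly C}) (rho : R) (c0 : C) (p : nat).
Hypotheses (f1 : (1 < size f)%N) (esc : escape_radius f rho).
Local Notation K := (filled_julia f).
Local Notation U k := (lemn (fpow f k) rho).
Local Notation P k := (comp (U k)).
Hypotheses (Kc0 : K c0) (p0 : (0 < p)%N) (c0p : comp K c0 (iterate f p c0)).
Hypothesis sole : forall c, root f^`() c -> K c -> c = c0.

(** [L] is the union of the components of K through the orbit of [c0], and [W M] that of the pieces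
    of depth [M] through it; [W M] decreases to [L]. *)
Let L w := exists j, comp K (iterate f j c0) w.
Let W M w := exists j, P M (iterate f j c0) w.

Lemma orbit_component_periodic j : exists2 i, (i < p)%N &
  comp K (iterate f i c0) (iterate f j c0).
Proof.
exists (j %% p)%N; first by rewrite ltn_mod.
rewrite {2}(divn_eq j p); elim: (j %/ p)%N => [|m IH].
  by rewrite mul0n add0n; apply: connected_component_refl; exact: (julia_iterate esc _ Kc0).
apply: (connected_component_trans IH); rewrite mulSn -addnA (addnC p) (iterateD f (m * p + j %% p) p).
exact: (julia_image esc).
Qed.

Lemma orbit_component_mul m : comp K c0 (iterate f (m * p) c0).
Proof.
elim: m => [|m IH]; first by rewrite mul0n; exact: connected_component_refl.
apply: (connected_component_trans IH); rewrite mulSn (addnC p) (iterateD f (m * p) p).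
exact: (julia_image esc).
Qed.

Lemma orbit_pieces_anti k l w : (k <= l)%N -> W l w -> W k w.
Proof. by move=> kl [j jw]; exists j; exact: (piece_anti esc kl). Qed.

(** Periodicity leaves finitely many orbit components, so one of the first [p] orbit points lies in
    the piece of [w] at every depth. *)
Lemma shrinking_orbit_pieces w : (forall k, W k w) -> L w.
Proof.
move=> Ww; apply: contrapT => nL.
have [||k kP] := @finite_exit R (fun k c => P k c w) [seq iterate f i c0 | i <- iota 0 p].
- by move=> k l c kl; exact: (piece_anti esc).
- move=> _ /mapP[i _ ->]; apply: contrapT => /forallNP h; apply: nL; exists i.
  apply: (pieces_julia esc); first exact: (julia_iterate esc _ Kc0).
  by move=> k; apply: contrapT; exact: h.
have [j jw] := Ww k; have [i ip ij] := orbit_component_periodic j.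
apply: (kP (iterate f i c0)); first by apply: map_f; rewrite mem_iota.
apply: connected_component_trans jw; exact: (julia_piece esc).
Qed.

(** The first [p] orbit points have finitely many preimages, and each one outside [L] leaves the
    orbit pieces at some depth. *)
Lemma isolating_depth : exists M0, forall M, (M0 <= M)%N ->
  forall i x, (i < p)%N -> f.[x] = iterate f i c0 -> W M x -> L x.
Proof.
pose s := flatten [seq rootseq (f - (iterate f i c0)%:P) | i <- iota 0 p].
have [||M0 M0P] := @finite_exit R W [seq x <- s | `[< ~ L x >]].
- by move=> k l x; exact: orbit_pieces_anti.
- move=> x; rewrite mem_filter => /andP[/asboolP nL _].
  by apply: contrapT => /forallNP h; apply: nL; apply: shrinking_orbit_pieces => k; apply: contrapT; exact: h.
exists M0 => M M0M i x ip fx Wx; apply: contrapT => nL.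
apply: (M0P x); last exact: orbit_pieces_anti Wx.
rewrite mem_filter; apply/andP; split; first exact/asboolP.
apply/flatten_mapP; exists i; first by rewrite mem_iota.
by rewrite mem_rootseq ?root_subC ?fx//; apply: nonconst_neq0; rewrite size_subC.
Qed.

(* If [u] and [f u] are both in orbit pieces of depth [M'], then the piece of depth [M'.+1] of [u]
   contains a preimage of some [f^i(c0)], which by isolation lies in the orbit of the component
   of [c0]: thus [u] is in an orbit piece of depth [M'.+1]. *)
Lemma trapped_orbit M w : (forall i x, (i < p)%N -> f.[x] = iterate f i c0 ->
    forall M', (M <= M')%N -> W M' x -> L x) ->
  K w -> (forall n, W M (iterate f n w)) -> L w.
Proof.
move=> iso Kw Ww.
have step j : forall n, W (M + j) (iterate f n w).
  elim: j => [n|j IH n]; first by rewrite addn0.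
  set M' := (M + j)%N in IH *; rewrite addnS -/M'.
  set u := iterate f n w.
  have Ku : K u by exact: (julia_iterate esc _ Kw).
  have [j' jfu] : W M' f.[u] by have := IH n.+1; rewrite /iterate iterS.
  have [i ip ij] := orbit_component_periodic j'.
  have ifu : P M' f.[u] (iterate f i c0).
    apply: (connected_component_trans (connected_component_sym jfu)).
    by apply: connected_component_sym; exact: (julia_piece esc).
  have [||x ux fx] := @piece_surj R f rho f1 M' 1 u (iterate f i c0).
  - exact: (julia_level esc).
  - exact: ifu.
  have [l lu] := IH n.
  have [l' l'x] : L x.
    apply: (iso i x ip fx M'); first by rewrite leq_addr.
    exists l; apply: (connected_component_trans lu).
    by apply: (@piece_anti _ _ _ esc _ (M' + 1)) ux; rewrite leq_addr.
  exists l'; rewrite -addn1; apply: connected_component_trans (connected_component_sym ux).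
  exact: (julia_piece esc).
apply: shrinking_orbit_pieces => k; apply: (@orbit_pieces_anti _ (M + k)); first by rewrite leq_addl.
exact: (step k 0%N).
Qed.

(** * Components without preimages of the critical point *)

Section Wandering.
Variable z0 : C.
Hypotheses (Kz0 : K z0)
  (avoid : forall w n, comp K z0 w -> iterate f n w <> c0).

(** From the component of f^j(c0), another j(p - 1) steps complete [j] periods and lead to the
    component of [c0]; lifting [c0] by [julia_surj] contradicts [avoid]. *)
Lemma avoid_orbit_components n : ~ L (iterate f n z0).
Proof.
move=> [j jz].
have : comp K (iterate f (j * p.-1 + n) z0) c0.
  apply: connected_component_sym; rewrite iterateD.
  apply: (connected_component_trans (orbit_component_mul j)).
  have -> : (j * p = j * p.-1 + j)%N by rewrite -mulnSr prednK.
  by rewrite iterateD; exact: (julia_image esc).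
by move=> /(julia_surj f1 esc Kz0)[w zw /avoid]; apply.
Qed.

Lemma escape_critical : exists k, forall c, root f^`() c -> U k c -> c = c0.
Proof.
have F'0 := deriv_neq0 f1.
have [||k kP] := @finite_exit R (fun k c => U k c) [seq c <- rootseq f^`() | c != c0].
- by move=> k l c kl; exact: (level_anti esc).
- move=> c; rewrite mem_filter mem_rootseq// => /andP[cc0 rc].
  apply: contrapT => /forallNP h; move/negP: cc0; apply; apply/eqP.
  by apply: sole => //; apply/(juliaP esc) => k; apply: contrapT; exact: h.
exists k => c rc Uc; apply/eqP; apply: contrapT => /negP cc0.
by apply: (kP c) => //; rewrite mem_filter cc0 mem_rootseq.
Qed.

(** The depth [M] isolates the orbit and excludes the escaping critical points. If f^n had a
    critical point in the piece of [z0] of depth M + n, the orbit of that point would pass through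
    [c0] and put f^n(z0) in an orbit piece. *)
Lemma returns : exists M, forall n0, exists2 n, (n0 <= n)%N &
  ~ W M (iterate f n z0) /\ forall z, P (M + n) z0 z -> ~~ root (fpow f n)^`() z.
Proof.
have [M0 M0P] := isolating_depth; have [k kP] := escape_critical.
pose M := maxn M0 k; exists M => n0.
have [n n0n nW] : exists2 n, (n0 <= n)%N & ~ W M (iterate f n z0).
  apply: contrapT => h; apply: (@avoid_orbit_components n0).
  apply: (@trapped_orbit M).
  - move=> i x ip fx M' MM'; apply: (M0P M' _ i) => //.
    by apply: leq_trans MM'; rewrite leq_maxl.
  - exact: (julia_iterate esc _ Kz0).
  - move=> n; apply: contrapT => nW; apply: h; exists (n + n0)%N; first by rewrite leq_addl.
    by rewrite iterateD.
exists n => //; split=> // z zP; apply/negP => /root_deriv_fpow[i ni ri].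
have Uz : U (M + n) z by exact: connected_component_sub zP.
have fi : iterate f i z = c0.
  apply: kP => //; rewrite -level_add; apply: (level_anti esc) Uz.
  by apply: leq_add; [rewrite leq_maxr|exact: ltnW].
apply: nW; exists (n - i)%N; rewrite -fi -iterateD subnK; last exact: ltnW.
by apply: connected_component_sym; exact: piece_image.
Qed.

Lemma wandering_trivial x y : comp K z0 x -> comp K z0 y -> x = y.
Proof.
move=> zx zy; apply/eqP; apply: contrapT => /negP xy.
have [rho0 esc'] := esc.
have [M MP] := returns.
pose J0 n := ~ W M (iterate f n z0) /\ forall z, P (M + n) z0 z -> ~~ root (fpow f n)^`() z.
have julia_rho w : K w -> N w <= rho.
  by move=> /(julia_level esc 0); rewrite mem_level => /ltW.
have [||q qP] := @bounded_cluster R J0 (fun n => iterate f n z0) rho.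
- by move=> m; have [n mn Jn] := MP m; exists n.
- by move=> n _; apply: julia_rho; exact: (julia_iterate esc _ Kz0).
have Kq : K q.
  apply: (julia_closed esc) => k.
  apply: ((closed_normcP _).1 (@closed_clemn R (fpow f k) rho)) => e e0.
  have [n [_ _ nq]] := qP e e0 0%N; exists (iterate f n z0) => //.
  by apply: lemn_clemn; apply: (julia_level esc); exact: (julia_iterate esc _ Kz0).
pose Q := P M q.
have oQ : open Q by apply: open_component; exact: open_lemn.
have Qq : Q q by apply: connected_component_refl; exact: (julia_level esc).
(* One level deeper than [Q], so that the images of the component of [z0] stay in the closed subset
   [D] of [Q] introduced below. *)
have [s [s0 sP]] : exists s, 0 < s /\ disc q s `<=` P M.+1 q.
  have [s s0 sP] := (open_normcP _).1 (@open_component R _ q (@open_lemn R (fpow f M.+1) rho)) q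
    (connected_component_refl (julia_level esc _ Kq)).
  by exists s.
pose J n := J0 n /\ disc q s (iterate f n z0).
have Jinf m : exists2 n, (m <= n)%N & J n.
  by have [n [mn Jn nq]] := qP s s0 m; exists n.
have JQ n : J n -> P M (iterate f n z0) = Q.
  move=> [_ /sP h]; apply/esym/same_connected_component.
  by apply: (piece_anti esc) h.
pose A n := P (M + n)%N z0.
have Uz0 k : U k z0 by exact: (julia_level esc).
have oA n : open (A n) by apply: open_component; exact: open_lemn.
have Aimg n z : J n -> A n z -> Q (iterate f n z).
  by move=> Jn; rewrite -(JQ n Jn); exact: piece_image.
have Asurj n w : J n -> Q w -> exists2 z, A n z & iterate f n z = w.
  by move=> Jn; rewrite -(JQ n Jn) => h; exact: (piece_surj f1 (Uz0 _) h).
have Ainj n a b : J n -> A n a -> A n b -> iterate f n a = iterate f n b -> a = b.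
  move=> [[_ nc] _]; rewrite /A fpowD => Aa Ab; rewrite -!horner_fpow.
  apply: (@noncritical_injective R (fpow f M) (fpow f n) rho z0) => //.
  - exact: size_fpow.
  - exact: size_fpow.
  - by rewrite -fpowD; exact: Uz0.
  - by rewrite -fpowD.
have Arho n z : A n z -> N z <= rho.
  move=> /connected_component_sub/(level_anti esc (leq0n _)).
  by rewrite mem_level => /ltW.
(* Bounds |z - b| for z in [A n] and |b| <= rho + 1. *)
pose R1 := 2 * rho + 1.
have R10 : 0 < R1 by rewrite /R1; lra.
(* By injectivity of f^n on [A n], the points of [A n] over the disc of radius r / 8 about [w] all
   lie in the component at [a] to which [harnack] applies. *)
have Aharnack n b w r k a : J n -> disc w r `<=` Q -> 0 < r -> ~ A n b -> N b <= rho + 1 ->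
    A n a -> iterate f n a = w -> N (a - b) <= R1 * (1 / 2) ^+ k.+1 ->
    forall z, A n z -> N (iterate f n z - w) <= r / 8 -> N (z - b) <= R1 * (3 / 4) ^+ k.+1.
  move=> Jn wQ r0 nAb br Aa aw ab z Az zw.
  have g1 : (1 < size (fpow f n))%N by exact: size_fpow.
  have gE u : (fpow f n - w%:P).[u] = iterate f n u - w by rewrite !hornerE horner_fpow.
  have sub : comp (lemn (fpow f n - w%:P) r) a `<=` A n.
    have in_level : comp (lemn (fpow f n - w%:P) r) a `<=` U (M + n).
      move=> u /connected_component_sub uw.
      have {}uw : N (iterate f n u - w) < r by move: uw; rewrite /lemn/= gE.
      by rewrite level_add; exact: connected_component_sub (wQ _ uw).
    apply: (component_absorb _ in_level _ Aa); first exact: component_connected.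
    by apply: connected_component_refl; rewrite /lemn/= gE aw subrr normc0.
  have za : comp (lemn (fpow f n - w%:P) r) a z.
    have zr : disc w r (iterate f n z) by apply: (le_lt_trans zw); lra.
    have wr : disc w r (fpow f n).[a] by rewrite horner_fpow aw; exact: disc_center.
    have [v av vz] := component_surj g1 (@open_disc R w r) (@connected_disc R w r) wr zr.
    have av' : comp (lemn (fpow f n - w%:P) r) a v.
      by apply: comp_mono av => u; rewrite /disc/= /lemn/= gE horner_fpow.
    by rewrite -(Ainj n v z Jn (sub _ av') Az _)// -vz horner_fpow.
  rewrite -horner_fpow in zw.
  apply: (@harnack R (fpow f n) w r b a R1 k g1 _ r0 R10 _ _ _ ab z za zw).
  - by rewrite horner_fpow.
  - by move=> u /sub; case: Jn => -[_ nc] _; exact: nc.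
  - by move=> /sub.
  - move=> u /sub/Arho ur; have := normcD u (- b); rewrite normcN /R1; lra.
(* Continuity at the point [rho], whose image has modulus at least 2 rho, gives [y0]; lifting [y0]
   by f^M into [Q] then gives a point [e] outside K. *)
have [y0 [y0r fy0]] : exists y0, N y0 < rho /\ rho <= N f.[y0].
  have [d d0 dP] := horner_cont f rho%:C rho0.
  pose m := Num.min d rho; have m0 : 0 < m by rewrite lt_min d0.
  have [md mr] : m <= d /\ m <= rho by split; rewrite ge_min lexx ?orbT.
  clearbody m; exists (rho - m / 2)%:C; rewrite normc_real ger0_norm; last by lra.
  split; first by lra.
  have /dP : N ((rho - m / 2)%:C - rho%:C) < d.
    have -> : (rho - m / 2)%:C - rho%:C = (- (m / 2))%:C by rewrite -rmorphB; congr (_%:C); ring.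
    by rewrite normc_real normrN ger0_norm; lra.
  have /esc' : rho <= N rho%:C by rewrite normc_real ger0_norm// ltW.
  rewrite normc_real ger0_norm; last exact: ltW.
  have := normc_triangle f.[(rho - m / 2)%:C] f.[rho%:C] 0.
  rewrite !subr0 (normcB f.[rho%:C]); lra.
have [e [Qe fe]] : exists e : C, Q e /\ rho <= N (iterate f M.+1 e).
  have [|||e qe fMe] := @component_surj R (fpow f M) (disc 0 rho) q y0 _
      (@open_disc R 0 rho) (@connected_disc R 0 rho).
  - exact: size_fpow.
  - by rewrite /disc/= subr0 horner_fpow -mem_level; exact: (julia_level esc).
  - by rewrite /disc/= subr0.
  exists e; split; first by apply: comp_mono qe => u; rewrite /disc/= subr0.
  by rewrite /iterate iterS -/(iterate f M e) -horner_fpow fMe.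
(* Otherwise discs of radius [eta] about preimages of [e] lie in [A n] for infinitely many n. Points
   near a cluster point of the centres lie in levels of every depth, hence in K, but a centre
   escapes. *)
have near_boundary eta : 0 < eta -> exists n1, forall n, (n1 <= n)%N -> J n ->
    exists en b, [/\ A n en, iterate f n en = e, ~ A n b & N (en - b) < eta].
  move=> eta0; apply: contrapT => /forallNP h.
  have {}h m : exists2 n, (m <= n)%N & J n /\ exists en, [/\ A n en, iterate f n en = e &
      disc en eta `<=` A n].
    apply: contrapT => h'; apply: (h m) => n mn Jn.
    have [en An fn] := Asurj n e Jn Qe.
    apply: contrapT => h2; apply: h'; exists n => //; split=> //; exists en; split=> //.
    move=> b enb; apply: contrapT => nb; apply: h2; exists en, b; split=> //.
    by rewrite normcB.
  have /choice[u uP] : forall n, exists en, (J n /\ exists en, [/\ A n en, iterate f n en = e &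
      disc en eta `<=` A n]) -> [/\ A n en, iterate f n en = e & disc en eta `<=` A n].
    move=> n; have [[_ [en enP]]|nh] := pselect (J n /\ exists en, [/\ A n en,
      iterate f n en = e & disc en eta `<=` A n]); last by exists 0.
    by exists en.
  have [|v vP] := @bounded_cluster R _ u rho h.
    by move=> n /uP[/Arho].
  have eta2 : 0 < eta / 2 by lra.
  have vK w : disc v (eta / 2) w -> K w.
    move=> vw; apply/(juliaP esc) => k.
    have [n [kn /uP[An _ uA] uv]] := vP _ eta2 k.
    have /uA : disc (u n) eta w.
      rewrite /disc/= in vw *; have := normc_triangle v w (u n); rewrite (normcB v (u n)); lra.
    move=> /connected_component_sub; apply: (level_anti esc).
    by rewrite (leq_trans kn)// leq_addl.
  have [n [_ /uP[An fn _] uv]] := vP _ eta2 0%N.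
  have : U (M.+1 + n) (u n) by apply: (julia_level esc); apply: vK.
  by rewrite level_add fn mem_level ltNge fe.
(* [good w]: if an omitted point [b] is close to the preimage of [e] in [A n], then it is close to
   all the preimages in [A n] of points near [w], uniformly in [n]. *)
pose good w := exists2 s, 0 < s & forall eps, 0 < eps -> exists2 eta, 0 < eta &
  forall n b en, J n -> ~ A n b -> N b <= rho + 1 -> A n en -> iterate f n en = e ->
    N (en - b) < eta -> forall z, A n z -> N (iterate f n z - w) < s -> N (z - b) < eps.
have small eps : 0 < eps -> exists k, R1 * (3 / 4) ^+ k.+1 < eps.
  move=> eps0; have [k kP] : exists k, (3 / 4 : R) ^+ k < eps / R1.
    have h : (fun k => (3 / 4 : R) ^+ k) @ \oo --> (0 : R).
      by apply: cvg_expr; rewrite ger0_norm; lra.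
    have er : 0 < eps / R1 by exact: divr_gt0.
    have [k _ kP] := cvgr0_norm_lt _ h _ er.
    exists k; have := kP k (leqnn k) => /=; rewrite ger0_norm// exprn_ge0//; lra.
  exists k; rewrite mulrC -ltr_pdivlMr//; apply: le_lt_trans kP.
  rewrite exprS ger_pMl ?exprn_gt0//; lra.
have half k : 0 < R1 * (1 / 2) ^+ k.+1 by rewrite mulr_gt0// exprn_gt0//; lra.
have goodQ : Q `<=` good.
  have Qgood : Q `<=` [set w | Q w /\ good w].
    apply: (@connected_open_split R Q _ [set w | Q w /\ ~ good w] e) => //.
    - exact: component_connected.
    - apply/open_normcP => w [Qw [s1 s10 s1P]].
      have [r r0 rQ] := (open_normcP _).1 oQ w Qw.
      exists (Num.min r (s1 / 2)); first by rewrite lt_min r0 divr_gt0.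
      move=> v; rewrite /disc/= lt_min => /andP[vr vs]; split; first exact: rQ.
      exists (s1 / 2); first exact: divr_gt0.
      move=> eps /s1P[eta eta0 etaP]; exists eta => // n b en Jn nb br An fn enb z Az zv.
      apply: (etaP n b en) => //; have := normc_triangle v (iterate f n z) w; lra.
    (* The complement is open: if [w1] near [w] is good, [Aharnack] started at the preimage of [w1]
       transfers the estimate to [w]. *)
    - apply/open_normcP => w [Qw ngw].
      have [r r0 rQ] := (open_normcP _).1 oQ w Qw.
      exists (r / 32); first by lra.
      move=> w1 ww1; rewrite /disc/= in ww1; have Qw1 : Q w1 by apply: rQ; rewrite /disc/=; lra.
      split=> // -[s1 s10 s1P]; apply: ngw; exists (r / 32); first by lra.
      move=> eps /small[k kP]; have [eta eta0 etaP] := s1P _ (half k).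
      exists eta => // n b en Jn nb br An fn enb z Az zw.
      have [a Aa fa] := Asurj n w1 Jn Qw1.
      apply: le_lt_trans kP; apply: (@Aharnack n b w1 (r / 2) k a) => //.
      + move=> v; rewrite /disc/= => vw1; apply: rQ; rewrite /disc/=.
        have := normc_triangle w1 v w; lra.
      + by lra.
      + by apply: ltW; apply: (etaP n b en) => //; rewrite fa subrr normc0.
      + have := normc_triangle w (iterate f n z) w1; rewrite (normcB w w1); lra.
    - by move=> w Qw; have [|] := pselect (good w); [left|right].
    - by rewrite -subset0 => w [[_ [_ h]] [_ /(_ h)]].
    - split=> //; have [r r0 rQ] := (open_normcP _).1 oQ e Qe.
      exists (r / 8); first by lra.
      move=> eps /small[k kP]; exists (R1 * (1 / 2) ^+ k.+1) => //.
      move=> n b en Jn nb br An fn enb z Az zw; apply: le_lt_trans kP.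
      by apply: (@Aharnack n b e r k en) => //; exact: ltW.
  by move=> w /Qgood[].
(* Being closed and contained in [Q], this set keeps the limits of the images of the component of
   [z0] inside [Q]. *)
pose D := comp (clemn (fpow f M.+1) rho) q.
have DQ : D `<=` Q by apply: comp_mono; exact: (clevel_level esc).
have orbD n w : J n -> comp K z0 w -> D (iterate f n w).
  move=> [_ /sP qz] zw; apply: comp_mono; first exact: lemn_clemn.
  apply: (connected_component_trans qz); apply: (julia_piece esc).
  exact: (julia_image esc).
have cD : closed D by apply: component_closed; exact: closed_clemn.
have orbN n w : comp K z0 w -> N (iterate f n w) <= rho.
  by move=> /connected_component_sub Kw; apply: julia_rho; exact: (julia_iterate esc _ Kw).
have extract (I : nat -> Prop) w : (forall n, I n -> J n) ->
    (forall m, exists2 n, (m <= n)%N & I n) -> comp K z0 w ->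
    exists2 v, good v & forall e', 0 < e' -> forall m, exists n,
      [/\ (m <= n)%N, I n & N (iterate f n w - v) < e'].
  move=> IJ Iinf zw.
  have [|v vP] := @bounded_cluster R I (fun n => iterate f n w) rho Iinf.
    by move=> n _; exact: orbN.
  exists v => //; apply: goodQ; apply: DQ; apply: ((closed_normcP _).1 cD) => e' e'0.
  have [n [_ /IJ Jn nv]] := vP e' e'0 0%N; exists (iterate f n w) => //.
  exact: orbD.
(* First a limit of the images of [x], then, along indices where they are near it, one of the images
   of [y], so that one index serves both. *)
have [vx [sx sx0 sxP] vxP] := extract J x (fun n h => h) Jinf zx.
pose I1 n := J n /\ N (iterate f n x - vx) < sx.
have I1inf m : exists2 n, (m <= n)%N & I1 n.
  by have [n [mn Jn nx]] := vxP sx sx0 m; exists n.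
have [vy [sy sy0 syP] vyP] := extract I1 y (fun n h => h.1) I1inf zy.
(* Both [x] and [y] will lie within less than this distance of the same omitted point [b]. *)
have eps0 : 0 < N (x - y) / 2 by rewrite divr_gt0// normc_gt0 subr_eq0.
have [ex ex0 exP] := sxP _ eps0; have [ey ey0 eyP] := syP _ eps0.
have eta0 : 0 < Num.min 1 (Num.min ex ey) by rewrite !lt_min ltr01 ex0.
have [n1 n1P] := near_boundary _ eta0.
have [n [n1n [Jn nx] ny]] := vyP sy sy0 n1.
have [en [b [An fn nAb]]] := n1P n n1n Jn.
rewrite !lt_min => /and3P[b1 bx by_].
have br : N b <= rho + 1.
  have := Arho n en An; have := normcD (b - en) en; rewrite subrK (normcB b); lra.
have xA w : comp K z0 w -> A n w by exact: (julia_piece esc).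
have h1 := exP n b en Jn nAb br An fn bx x (xA x zx) nx.
have h2 := eyP n b en Jn nAb br An fn by_ y (xA y zy) ny.
have := normc_triangle b x y; rewrite (normcB b y); lra.
Qed.

End Wandering.
End Shrinking.

(** * Green's function and the periodic component *)

Section GreenFunction.
Variable R : realType.
Local Notation C := R[i].
Local Notation N := (@ComplexField.Normc.normc R).
Local Notation comp := (@connected_component C).
Implicit Types (f : {poly C}) (x y z w c a b : C) (e r t D B : R).

Lemma cvg_divX D B : 1 < D -> (fun n => B / D ^+ n) @ \oo --> (0 : R).
Proof.
move=> D1; have -> : (fun n => B / D ^+ n) = geometric B D^-1.
  by apply/funext => n; rewrite /geometric/= exprVn.
apply: cvg_geometric; rewrite ger0_norm ?invr_ge0; last by lra.
by rewrite invf_lt1//; lra.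
Qed.

(* (a_n - B) / D^n is nondecreasing and (a_n + B) / D^n is nonincreasing. *)
Lemma cvg_rescaled D B (a : nat -> R) : 2 <= D -> 0 <= B ->
  (forall n, `|a n.+1 - D * a n| <= B) ->
  exists2 l, (fun n => a n / D ^+ n) @ \oo --> l & a 0%N - B <= l.
Proof.
move=> D2 B0 aD; have D0 : 0 < D by lra.
have Dn0 n : 0 < D ^+ n by exact: exprn_gt0.
pose v n := (a n - B) / D ^+ n; pose w n := (a n + B) / D ^+ n.
have DB : 2 * B <= D * B by rewrite ler_wpM2r.
have vS n : v n <= v n.+1.
  rewrite /v exprS invfM mulrA ler_wpM2r ?invr_ge0 ?(ltW (Dn0 n))//.
  rewrite ler_pdivlMr//; have := aD n; rewrite ler_norml => /andP[h _].
  by rewrite mulrBl (mulrC (a n)) (mulrC B); lra.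
have wS n : w n.+1 <= w n.
  rewrite /w exprS invfM mulrA ler_wpM2r ?invr_ge0 ?(ltW (Dn0 n))//.
  rewrite ler_pdivrMr//; have := aD n; rewrite ler_norml => /andP[_ h].
  by rewrite mulrDl (mulrC (a n)) (mulrC B); lra.
have vnd : {homo v : n m / (n <= m)%N >-> n <= m} by apply/nondecreasing_seqP.
have wni n : w n <= w 0%N by elim: n => [//|n IH]; exact: le_trans (wS n) IH.
have vw n : v n <= w n.
  by rewrite /v /w ler_wpM2r ?invr_ge0 ?(ltW (Dn0 n))//; lra.
have cv : cvgn v.
  apply: nondecreasing_is_cvgn => //; exists (w 0%N) => _ [n _ <-].
  exact: le_trans (vw n) (wni n).
exists (limn v).
  have -> : (fun n => a n / D ^+ n) = v \+ (fun n => B / D ^+ n).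
    by apply/funext => n; rewrite /v/= -mulrDl subrK.
  rewrite -[limn v]addr0; apply: cvgD => //.
  by apply: cvg_divX; lra.
have -> : a 0%N - B = v 0%N by rewrite /v expr0 divr1.
by apply: limr_ge => //; near=> n; exact: vnd.
Unshelve. all: by end_near. Qed.

Lemma green_julia f z : (2 < size f)%N -> filled_julia f z -> green f z = 0.
Proof.
move=> f2 [M [Mreal Mb]]; set D : R := (size f).-1%:R.
have D1 : 1 < D by rewrite ltr1n; case: (size f) f2 => [|[]].
pose m := `|complex.Re M| + 1.
have m1 : 1 <= m by rewrite lerDr.
have {}Mb n : N (iterate f n z) <= m.
  have : `|iterate f n z| <= m%:C.
    apply: Mb => //; rewrite -(RRe_real Mreal) ltcR /m.
    by have := ler_norm (complex.Re M); lra.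
  by rewrite norm_normc lecR.
apply: cvg_lim => //.
apply: (@squeeze_cvgr _ _ _ _ (fun=> 0) (fun n => ln m / D ^+ n)).
- near=> n; apply/andP; split.
    by rewrite divr_ge0 ?exprn_ge0// ?ler0n// ln_ge0// le_max lexx.
  rewrite ler_wpM2r ?invr_ge0 ?exprn_ge0 ?ler0n//.
  rewrite ler_ln ?posrE ?lt_max ?ltr01//; last by lra.
  by rewrite ge_max m1 Mb.
- exact: cvg_cst.
- exact: cvg_divX.
Unshelve. all: by end_near. Qed.

(** Far out, ln |f(z)| differs from D ln |z| by at most [B], so ln |f^n(z)| / D^n converges to a
    limit at least ln |z| - B. *)
Lemma green_escape f : (2 < size f)%N -> exists2 rho, escape_radius f rho &
  forall M z, rho <= N (iterate f M z) -> ((size f).-1%:R ^+ M)^-1 <= green f z.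
Proof.
move=> f2; have f1 : (1 < size f)%N by exact: ltnW.
have f0 := nonconst_neq0 f1; set D : R := (size f).-1%:R.
have D2 : 2 <= D by rewrite ler_nat; case: (size f) f2 => [|[|[]]].
have [rho1 rho10 rho1P] := normc_horner_bounds f0.
have lc0 := normc_lead_gt0 f0; set lc := N _ in lc0 rho1P.
have ln2 : 0 < ln (2 : R) by rewrite ln_gt0// ltr1n.
pose B := `|ln lc| + D * ln 2.
have B0 : 0 <= B by rewrite addr_ge0// mulr_ge0 ?(ltW ln2)//; lra.
have lnf z : rho1 <= N z -> `|ln (N f.[z]) - D * ln (N z)| <= B.
  move=> zr; have [lo up] := rho1P z zr.
  have z0 : 0 < N z by exact: lt_le_trans zr.
  have z20 : 0 < N z / 2 by exact: divr_gt0.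
  have z2 : 0 < 2 * N z by exact: mulr_gt0.
  have lo0 : 0 < lc * (N z / 2) ^+ (size f).-1 by rewrite mulr_gt0// exprn_gt0.
  have up0 : 0 < lc * (2 * N z) ^+ (size f).-1 by rewrite mulr_gt0// exprn_gt0.
  have fz0 : 0 < N f.[z] by exact: lt_le_trans lo.
  have {}lo : ln (lc * (N z / 2) ^+ (size f).-1) <= ln (N f.[z]) by rewrite ler_ln ?posrE.
  have {}up : ln (N f.[z]) <= ln (lc * (2 * N z) ^+ (size f).-1) by rewrite ler_ln ?posrE.
  move: lo up; rewrite !lnM ?posrE ?exprn_gt0// !lnXn// ln_div ?posrE// lnM ?posrE//.
  rewrite -[(_ - _) *+ _]mulr_natl -[(_ + _) *+ _]mulr_natl -/D mulrBr mulrDr => lo up.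
  have := ler_norm (ln lc); have := ler_norm (- ln lc); rewrite normrN /B.
  move=> h1 h2; rewrite ler_norml; apply/andP; split; lra.
(* The terms B + 1 make the limit at least 1, and the further ln 2 makes the modulus double. *)
pose rho := Num.max rho1 (expR (B + 1 + ln 2)).
have [r1 r2] : rho1 <= rho /\ expR (B + 1 + ln 2) <= rho.
  by rewrite !le_max !lexx orbT.
clearbody rho; have rho0 : 0 < rho by exact: lt_le_trans r1.
have lnrho z : rho <= N z -> B + 1 + ln 2 <= ln (N z).
  move=> zr; rewrite -[leLHS]expRK ler_ln ?posrE ?expR_gt0//.
    exact: le_trans zr.
  exact: lt_le_trans zr.
have esc : escape_radius f rho.
  split=> // z zr; have /lnf := le_trans r1 zr; rewrite ler_norml => /andP[h _].
  have z0 : 0 < N z by exact: lt_le_trans zr.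
  have lz := lnrho z zr.
  have Dz : 2 * ln (N z) <= D * ln (N z) by rewrite ler_wpM2r//; lra.
  have fz0 : 0 < N f.[z].
    have [lo _] := rho1P z (le_trans r1 zr); apply: lt_le_trans lo.
    by rewrite mulr_gt0// exprn_gt0// divr_gt0.
  rewrite -ler_ln ?posrE ?mulr_gt0// lnM ?posrE//; lra.
exists rho => // M z zr.
have big n : rho <= N (iterate f (n + M) z).
  elim: n => [//|n IH]; rewrite addSn {1}/iterate iterS -/(iterate _ _ _).
  by have [_ /(_ _ IH)] := esc; have := normc_ge0 (iterate f (n + M) z); lra.
pose a n := ln (N (iterate f (n + M) z)).
have [|l al la] := @cvg_rescaled D B a D2 B0.
  move=> n; rewrite /a addSn {1}/iterate iterS -/(iterate _ _ _); apply: lnf.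
  exact: le_trans r1 (big n).
have rho1' : 1 <= rho.
  by apply: le_trans r2; rewrite -[leLHS]expR0 ler_expR; lra.
have -> : green f z = l / D ^+ M.
  apply: cvg_lim => //; rewrite -(cvg_shiftn M).
  have -> : (fun n => ln (Num.max 1 (N (iterate f (n + M) z))) / D ^+ (n + M)) =
      (fun n => a n / D ^+ n * (D ^+ M)^-1).
    apply/funext => n; rewrite exprD invfM mulrA /a; congr (ln _ / _ / _).
    by apply/max_idPr; exact: le_trans (big n).
  by apply: cvgMl.
rewrite -[leLHS]mul1r ler_wpM2r ?invr_ge0 ?exprn_ge0 ?ler0n//.
apply: le_trans la; have := lnrho _ zr; rewrite /a add0n; lra.
Qed.

End GreenFunction.

(** * From the periodic tableau to the component of the critical point *)

Section Periodic.
Variable R : realType.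
Local Notation C := R[i].
Local Notation N := (@ComplexField.Normc.normc R).
Local Notation comp := (@connected_component C).
Variables (f : {poly C}) (rho : R) (c0 : C) (p : nat).
Hypotheses (f2 : (2 < size f)%N) (esc : escape_radius f rho).
Hypothesis green_low :
  forall M z, rho <= N (iterate f M z) -> ((size f).-1%:R ^+ M)^-1 <= green f z.
Local Notation K := (filled_julia f).
Hypothesis Kc0 : K c0.

(** Green's function is at least D^(-M) outside the level of depth [M], so that level contains {G <=
    G0 / D^k} for some k, and with it the puzzle piece containing c_0 and c_p. *)
Lemma tableau_periodic_component (G0 : R) : 0 < G0 ->
  (forall k, puzzle_piece f G0 k (iterate f p c0) = puzzle_piece f G0 k c0) ->
  comp K c0 (iterate f p c0).
Proof.
move=> G00 per; set D : R := (size f).-1%:R.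
have D1 : 1 < D by rewrite ltr1n; case: (size f) f2 => [|[]].
have Dn0 n : 0 < D ^+ n by apply: exprn_gt0; lra.
apply: (pieces_julia esc Kc0) => M.
have DM := Dn0 M.
have [k kP] : exists k, G0 / D ^+ k < (D ^+ M)^-1.
  have h := @cvg_divX R D G0 D1.
  have DV : 0 < (D ^+ M)^-1 by rewrite invr_gt0.
  have [k _ kP] := cvgr0_norm_lt _ h _ DV.
  by exists k; have := kP k (leqnn k) => /=; rewrite ger0_norm// divr_ge0 ?(ltW (Dn0 k)) ?(ltW G00).
have : puzzle_piece f G0 k c0 (iterate f p c0).
  rewrite -per; apply: connected_component_refl => /=.
  rewrite (green_julia f2); last exact: (julia_iterate esc _ Kc0).
  by apply: divr_ge0; [exact: ltW|exact: ltW (Dn0 k)].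
apply: comp_mono => w /= wk; rewrite mem_level ltNge; apply/negP => /green_low.
by rewrite -/D in wk *; lra.
Qed.

(** As [c0] is a critical fixed point of f^p, the difference f^p - c0 is divisible by (z - c0)^2, so
    f^p maps a small disc about [c0] into itself and the disc lies in K. *)
Lemma superattracting_nontrivial : (0 < p)%N -> root f^`() c0 -> iterate f p c0 = c0 ->
  exists2 y, comp K c0 y & y <> c0.
Proof.
move=> p0 rc0 per; have f1 : (1 < size f)%N by exact: ltnW.
have h1 := size_fpow p f1; set h := fpow f p in h1.
have hc0 : h.[c0] = c0 by rewrite horner_fpow.
have rh : root h^`() c0.
  rewrite /h -(prednK p0) -addn1 fpowD fpow1 deriv_comp rootM rc0 orbT.
  by [].
pose G := h - c0%:P.
have G0 : G != 0 by apply: nonconst_neq0; rewrite size_subC.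
have Gc0 : root G c0 by rewrite root_subC hc0.
have [u uc GE] := mup_factor c0 G0.
have : (1 < mup c0 G)%N.
  rewrite mup_deriv// derivB derivC subr0 ltnS -XsubC_dvd ?deriv_neq0//.
  by rewrite dvdp_XsubCl.
case: (mup c0 G) GE => [|[|m]] // GE _.
pose v := u * ('X - c0%:P) ^+ m.
have vE z : h.[z] - c0 = v.[z] * (z - c0) ^+ 2.
  have <- : G.[z] = h.[z] - c0 by rewrite !hornerE.
  rewrite GE /v -addn2 exprD mulrA hornerM [X in _ * X]horner_exp hornerXsubC.
  by [].
have [rho0 esc'] := esc.
have c0rho : N c0 < rho by have := julia_level esc 0 Kc0; rewrite mem_level.
have [d d0 dP] := horner_cont v c0 (@ltr01 R).
pose B := N v.[c0] + 1.
have B0 : 0 < B by have := normc_ge0 v.[c0]; rewrite /B; lra.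
(* On the disc |v| <= B and |z - c0| <= 1 / B, so f^p does not increase the distance to [c0]; the
   last bound keeps the disc inside the escape radius. *)
pose r := Num.min d (Num.min B^-1 (rho - N c0)).
have r0 : 0 < r by rewrite !lt_min d0 invr_gt0 B0 subr_gt0.
have [rd rB rr] : [/\ r <= d, r <= B^-1 & r <= rho - N c0].
  by split; rewrite !ge_min lexx ?orbT.
clearbody r.
have hr z : disc c0 r z -> disc c0 r h.[z].
  rewrite /disc/= => zr; rewrite vE normcM normcX.
  have vB : N v.[z] <= B.
    have := dP z (lt_le_trans zr rd); have := normcD (v.[z] - v.[c0]) v.[c0].
    rewrite subrK /B; lra.
  have zB := ltW (lt_le_trans zr rB).
  apply: le_lt_trans zr; rewrite expr2 mulrA ler_piMl ?normc_ge0//.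
  apply: (@le_trans _ _ (B * B^-1)); last by rewrite divff// gt_eqF.
  by apply: ler_pM => //; rewrite normc_ge0.
have rK : disc c0 r `<=` K.
  move=> z zr; apply/(juliaP esc) => k.
  apply: (@level_anti _ _ _ esc _ (k * p)); first by rewrite leq_pmulr.
  have : disc c0 r (iterate f (k * p) z).
    elim: k => [//|k IH]; rewrite mulSn iterateD -horner_fpow; exact: hr.
  rewrite mem_level /disc/= => h2; have := normcD (iterate f (k * p) z - c0) c0.
  rewrite subrK; lra.
exists (c0 + (r / 2)%:C).
  apply: (@connected_component_max _ _ (disc c0 r)) => //.
  - exact: disc_center.
  - exact: connected_disc.
  - rewrite /disc/= addrC addKr normc_real ger0_norm; lra.
move=> /eqP; rewrite -subr_eq0 addrC addKr -normc_eq0 normc_real ger0_norm.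
  by move=> /eqP; lra.
by lra.
Qed.

End Periodic.

Unset Implicit Arguments.

Theorem theorem5 (R : realType) (d : nat) (f : {poly R[i]}) (c0 : R[i])
    (G0 : R) (p : nat)
    (hd : (3 <= d)%N) (hf : size f = d.+1)
    (hc0 : sole_bounded_critical_point f c0)
    (hG0 : puzzle_level f G0)
    (hp : critical_tableau_periodic f G0 c0 p) :
  nontrivial (connected_component (filled_julia f) c0) /\
  forall z0 : R[i], filled_julia f z0 ->
    (nontrivial (connected_component (filled_julia f) z0) <->
     exists z : R[i], connected_component (filled_julia f) z0 z /\
       exists n : nat, iterate f n z = c0).
Proof.
have f2 : (2 < size f)%N by rewrite hf ltnS ltnW.
have f1 : (1 < size f)%N by exact: ltnW.
have [Kc0 mupc0 sole] := hc0; have [G00 _ _] := hG0; have [p0 per] := hp.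
have [rho esc low] := green_escape f2.
have c0p := tableau_periodic_component f2 esc low Kc0 G00 per.
have nt0 : nontrivial (connected_component (filled_julia f) c0).
  have refl0 := connected_component_refl Kc0.
  have [fp|/eqP fp] := eqVneq (iterate f p c0) c0; last first.
    by exists (iterate f p c0), c0.
  have rc0 : root f^`() c0.
    by rewrite -dvdp_XsubCl XsubC_dvd ?deriv_neq0// mupc0.
  have [y y0 yc] := superattracting_nontrivial f2 esc Kc0 p0 rc0 fp.
  by exists y, c0.
split=> // z0 Kz0; split=> [[x [y [zx zy xy]]]|[z [z0z [n fz]]]].
  apply: contrapT => h; apply: xy.
  apply: (wandering_trivial f1 esc Kc0 p0 c0p sole Kz0 _ zx zy).
  by move=> w n zw fw; apply: h; exists w; split=> //; exists n.
(* f^n maps the component of [z] onto that of [c0], so two points of the latter lift to two points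
   of the former. *)
rewrite (same_connected_component z0z); have [a [b [ca cb ab]]] := nt0.
have Kz := connected_component_sub z0z.
rewrite -fz in ca cb.
have [x zx fx] := julia_surj f1 esc Kz ca; have [y zy fy] := julia_surj f1 esc Kz cb.
by exists x, y; split=> // xy; apply: ab; rewrite -fx -fy xy.
Qed.
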